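(* Let $T_A$ be the rearrangement group of the Airplane limit space and let $E=\{f\in T_A : D_p(f)=1\ \text{for all } p\in\mathcal{E}\}$, where $\mathcal E$ is the set of external extremes of rays and $D_p$ denotes the extremal derivative at $p$. The group $E$ acts 2-transitively on the set of components of the Airplane limit space. In particular, the groups $[T_A,T_A]$ and $T_A$ act 2-transitively on the set of components.
   Context: The Airplane rearrangement group $T_A$. Graphs are finite directed multigraphs with edges coloured red or blue. The base graph $\Gamma$ has vertices $l,a,b,r$, blue edges $e_L:a\to l$ and $e_R:b\to r$, and red edges $e_U:b\to a$ and $e_D:a\to b$. Replacement rules: a red edge from $v_i$ to $v_t$ is replaced by the graph with vertices $v_i,v_t$ and two new vertices $m,w$, with red edges $\mathsf r_1:v_i\to m$, $\mathsf r_2:m\to v_t$ and a blue edge $\mathsf s:m\to w$; a blue edge from $v_i$ to $v_t$ is replaced by the graph with vertices $v_i,v_t$ and two new vertices $x,y$, with blue edges $\mathsf b_-:x\to v_i$, $\mathsf b_+:y\to v_t$ and red edges $\mathsf u:y\to x$, $\mathsf d:x\to y$. An expansion is any graph obtained from $\Gamma$ by finitely many (possibly zero) replacements of single edges. Each edge of an expansion is named by the finite word $e_0e_1\cdots e_k$ recording the edge $e_0$ of $\Gamma$ from which it descends and the successive edges of replacement graphs. Let $\Gamma_0=\Gamma$, and let $\Gamma_{n+1}$ be obtained from $\Gamma_n$ by replacing every edge. Let $\Omega$ be the set of infinite words all of whose finite nonempty prefixes name edges (topologized as a subspace of a product of finite discrete sets). Two such words $e_0e_1\cdots$ and $f_0f_1\cdots$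 are equivalent if for every $n$ the edges $e_0\cdots e_n$ and $f_0\cdots f_n$ of $\Gamma_n$ share at least one vertex; this is an equivalence relation, and the Airplane limit space $A$ is the quotient of $\Omega$ by it, with the quotient topology. Each vertex $v$ of an expansion is identified with the point of $A$ represented by the words all of whose sufficiently long prefixes name edges incident to $v$. The cell $\chi(e)$ of an edge $e$ is the set of points of $A$ represented by words beginning with $e$. A cellular partition is a cover of $A$ by finitely many cells with pairwise disjoint interiors. If $e,e'$ are edges of the same colour, the canonical homeomorphism $\chi(e)\to\chi(e')$ sends the class of $ew$ to the class of $e'w$. A rearrangement is a homeomorphism $f:A\to A$ for which there is a cellular partition such that $f$ restricts on each of its cells to a canonical homeomorphism onto some cell. Rearrangements form a group $T_A$ under composition. Components. The central component $C_0$ corresponds to the pair of red edges $e_U,e_D$ of $\Gamma$; every blue edge $e$ of an expansion determines another component, corresponding to the pair of red edges $e\mathsf u,e\mathsf d$. The boundary $\partial C$ of the component with red edges $c_1,c_2$ is the set of points represented by words $c_iw$ with all letters of $w$ in $\{\mathsf r_1,\mathsf r_2\}$; it is homeomorphic to a circle. Each $f\in T_A$ maps boundaries of components to boundaries of components, hence acts on the set of components. Graph pair diagrams. Each $f\in T_A$ is represented by graph pair diagrams: isomorphisms $\varphi:D\to R$ between expansions, preserving colours and the directions of red edges (directions of blue edges are ignored), such that for each edge $e$ of $D$, $f$ maps $\chi(e)$ onto $\chi(\varphi(e))$ canonically, or, if $e$ is blue and $\varphi$ reverses its direction, by the map sending the classes of $e\mathsf b_\pm w$, $e\mathsf u w$,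 $e\mathsf d w$ to those of $\varphi(e)\mathsf b_\mp w$, $\varphi(e)\mathsf d w$, $\varphi(e)\mathsf u w$. Expanding an edge of $D$ and its image in $R$ gives another diagram for $f$; the reduced diagram of $f$ is the unique one that is not an expansion of another. Extremal derivatives. Call a blue edge radial if it is $e_L$, $e_R$, or its word ends with $\mathsf s$. Rays are in bijection with radial edges: the ray of $e$ is the set of points represented by words $ew$ with $w$ not containing $\mathsf s$, minus its two extreme points, which are the endpoints of $e$. The external extreme of the ray is the terminal vertex of $e$, and $\mathcal E\subset A$ is the set of external extremes of all rays; $T_A$ permutes $\mathcal E$. Every blue edge is uniquely of the form $et$ with $e$ radial and $t$ a word of length $k\ge0$ in $\mathsf b_-,\mathsf b_+$; its length is $1/2^k$. Let $p\in\mathcal E$, $f\in T_A$, with reduced graph pair diagram $\varphi:D\to R$. If $p$ is not a vertex of $D$, set $D_p(f)=1$. Otherwise $p$ is an endpoint of a unique edge $e_p$ of $D$, which is blue, and the extremal derivative $D_p(f)$ is the ratio of the length of $\varphi(e_p)$ to the length of $e_p$. *)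

(* Defs.v *)
From HB Require Import structures.
From mathcomp Require Import all_boot all_order all_algebra.
From mathcomp Require Import all_classical all_reals all_analysis.

Set Implicit Arguments.
Unset Strict Implicit.
Unset Printing Implicit Defensive.

Import Order.TTheory GRing.Theory Num.Theory.

Local Open Scope classical_set_scope.
Local Open Scope quotient_scope.

(** * Words, edges and vertices *)

(* The edges of the base graph, of the red replacement graph (r_1, r_2, s_)
   and of the blue replacement graph (b_m = b_-, b_p = b_+, u_, d_). *)
Inductive letter := e_L | e_R | e_U | e_D | r_1 | r_2 | s_ | b_m | b_p | u_ | d_.

Definition letter_code (c : letter) : 'I_11 :=
  match c with
  | e_L => @Ordinal 11 0 isT
  | e_R => @Ordinal 11 1 isT
  | e_U => @Ordinal 11 2 isT
  | e_D => @Ordinal 11 3 isT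
  | r_1 => @Ordinal 11 4 isT
  | r_2 => @Ordinal 11 5 isT
  | s_ => @Ordinal 11 6 isT
  | b_m => @Ordinal 11 7 isT
  | b_p => @Ordinal 11 8 isT
  | u_ => @Ordinal 11 9 isT
  | d_ => @Ordinal 11 10 isT
  end.

Definition letter_decode (i : 'I_11) : letter :=
  nth e_L [:: e_L; e_R; e_U; e_D; r_1; r_2; s_; b_m; b_p; u_; d_] i.

Lemma letter_codeK : cancel letter_code letter_decode.
Proof. by case. Qed.

HB.instance Definition _ := Finite.copy letter (can_type letter_codeK).

Definition word : Type := seq letter.

Inductive colour := Red | Blue.

Definition letter_colour (c : letter) : colour :=
  match c with
  | e_U | e_D | r_1 | r_2 | u_ | d_ => Red
  | e_L | e_R | s_ | b_m | b_p => Blue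
  end.

Definition edge_colour (e : word) : colour := letter_colour (last e_L e).

Definition replacement (k : colour) : seq letter :=
  match k with
  | Red => [:: r_1; r_2; s_]
  | Blue => [:: b_m; b_p; u_; d_]
  end.

Definition is_edge (e : word) : bool :=
  if e is c :: w
  then (c \in [:: e_L; e_R; e_U; e_D])
       && path (fun a b => b \in replacement (letter_colour a)) c w
  else false.

(* The new vertices created by replacing an edge carry the name of that edge:
   m, w for a red edge and x, y for a blue one. *)
Inductive vertex :=
  V_l | V_a | V_b | V_r
| V_m of word | V_w of word | V_x of word | V_y of word.

(* (initial vertex, terminal vertex); the other letters do not occur here *)
Definition base_ends (c : letter) : vertex * vertex :=
  match c with
  | e_L => (V_a, V_l)
  | e_R => (V_b, V_r)
  | e_U => (V_b, V_a)
  | _ => (V_a, V_b)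
  end.

Definition sub_ends (e : word) (v : vertex * vertex) (c : letter) :
    vertex * vertex :=
  match c with
  | r_1 => (v.1, V_m e)
  | r_2 => (V_m e, v.2)
  | s_ => (V_m e, V_w e)
  | b_m => (V_x e, v.1)
  | b_p => (V_y e, v.2)
  | u_ => (V_y e, V_x e)
  | d_ => (V_x e, V_y e)
  | _ => v
  end.

(* the argument is the reversed name of the edge *)
Fixpoint ends_rev (e : word) : vertex * vertex :=
  match e with
  | [::] => (V_l, V_l)
  | [:: c] => base_ends c
  | c :: e' => sub_ends (rev e') (ends_rev e') c
  end.

Definition ends (e : word) : vertex * vertex := ends_rev (rev e).
Definition initial (e : word) : vertex := (ends e).1.
Definition terminal (e : word) : vertex := (ends e).2.

Definition incident (v : vertex) (e : word) : Prop :=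
  v = initial e \/ v = terminal e.

(** * Expansions, as sets of edges *)

Definition subedges (e : word) : set word :=
  [set rcons e c | c in [set` replacement (edge_colour e)]].

Definition replace (D : set word) (e : word) : set word :=
  (D `\ e) `|` subedges e.

Inductive expansion : set word -> Prop :=
| expansion_base :
    expansion [set` [:: [:: e_L]; [:: e_R]; [:: e_U]; [:: e_D]]]
| expansion_replace D e : expansion D -> D e -> expansion (replace D e).

Definition vertices (D : set word) : set vertex :=
  [set v | exists2 e, D e & incident v e].

(** * The limit space *)

Definition stream_prefix (x : nat -> letter) (n : nat) : word := mkseq x n.

Definition cat_stream (e : word) (w : nat -> letter) : nat -> letter :=
  fun n => nth (w (n - size e)) e n.

Definition letter_streams : Type :=
  prod_topology (fun _ : nat => discrete_topology letter).

Definition Omega_set : set letter_streams :=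
  [set x | forall n, is_edge (stream_prefix x n.+1)].

(* carries the subspace topology *)
Definition Omega : Type := set_type Omega_set.
HB.instance Definition _ := Topological.on Omega.

Definition stream (x : Omega) : nat -> letter := set_val x.

Definition equivalent (x y : Omega) : Prop :=
  forall n, exists v, incident v (stream_prefix (stream x) n.+1) /\
                      incident v (stream_prefix (stream y) n.+1).

Lemma ends_rcons e c : e != [::] -> ends (rcons e c) = sub_ends e (ends e) c.
Proof.
rewrite /ends rev_rcons => e0 /=.
have : rev e != [::] by rewrite -size_eq0 size_rev size_eq0.
by case E: (rev e) => [//|a t] _; rewrite -E revK.
Qed.

Definition vertex_name (v : vertex) : word :=
  match v with
  | V_m e | V_w e | V_x e | V_y e => e
  | _ => [::]
  end.

Lemma incident_level v e : e != [::] -> incident v e ->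
  size (vertex_name v) < size e.
Proof.
elim/last_ind: e v => [//|e c IH] v _.
have [->|e0] := eqVneq e [::].
  by rewrite /incident /initial /terminal; case: c => -[] ->.
have [IH1 IH2] : size (vertex_name (ends e).1) < size e /\
                 size (vertex_name (ends e).2) < size e.
  by split; apply: IH => //; [left|right].
rewrite /incident /initial /terminal ends_rcons // size_rcons ltnS.
by case: c => -[] -> /=; rewrite ?leqnn // ltnW.
Qed.

Lemma incident_rcons v e c : e != [::] -> incident v (rcons e c) ->
  incident v e \/ vertex_name v = e.
Proof.
move=> e0; rewrite /incident /initial /terminal ends_rcons //.
by case: c => -[] -> /=; auto.
Qed.

Lemma is_edge_rcons e c : e != [::] -> is_edge (rcons e c) ->
  c \in [:: r_1; r_2; s_; b_m; b_p; u_; d_].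
Proof.
case: e => [//|a t] _ /=; rewrite rcons_path => /andP[_ /andP[_]].
by case: (letter_colour _); case: c.
Qed.

Lemma incident_once v v' e c : e != [::] -> is_edge (rcons e c) ->
  incident v e -> incident v' e ->
  incident v (rcons e c) -> incident v' (rcons e c) -> v = v'.
Proof.
move=> e0 /is_edge_rcons - /(_ e0) cP ve v'e.
have lv : vertex_name v <> e.
  by move=> E; have := incident_level e0 ve; rewrite E ltnn.
have lv' : vertex_name v' <> e.
  by move=> E; have := incident_level e0 v'e; rewrite E ltnn.
rewrite /incident /initial /terminal ends_rcons //.
case: c cP => // _ [Ev|Ev] [Ev'|Ev'];
  solve [ by rewrite Ev Ev' | by case: lv; rewrite Ev
        | by case: lv'; rewrite Ev' ].
Qed.

Lemma equivalent_refl : reflexive (fun x y => `[< equivalent x y >]).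
Proof.
move=> x; apply/asboolP => n.
by exists (initial (stream_prefix (stream x) n.+1)); split; left.
Qed.

Lemma equivalent_sym : symmetric (fun x y => `[< equivalent x y >]).
Proof.
by move=> x y; apply/idP/idP => /asboolP xy; apply/asboolP => n;
  have [v [? ?]] := xy n; exists v.
Qed.

Lemma stream_prefixS x n :
  stream_prefix x n.+1 = rcons (stream_prefix x n) (x n).
Proof. by rewrite /stream_prefix /mkseq -[n.+1]addn1 iotaD map_cat cats1. Qed.

Lemma incident_prefix x y n v :
  stream_prefix x n.+1 <> stream_prefix y n.+1 ->
  incident v (stream_prefix x n.+2) -> incident v (stream_prefix y n.+2) ->
  incident v (stream_prefix x n.+1) /\ incident v (stream_prefix y n.+1).
Proof.
move=> neq; rewrite (stream_prefixS x n.+1) (stream_prefixS y n.+1).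
have [x0 y0] : stream_prefix x n.+1 != [::] /\ stream_prefix y n.+1 != [::].
  by [].
have sxy : size (stream_prefix x n.+1) = size (stream_prefix y n.+1).
  by rewrite !size_mkseq.
move=> /(incident_rcons x0)[vx|vx] /(incident_rcons y0)[vy|vy] //.
- by have := incident_level x0 vx; rewrite vy sxy ltnn.
- by have := incident_level y0 vy; rewrite vx sxy ltnn.
- by case: neq; rewrite -vx -vy.
Qed.

Lemma equivalent_trans : transitive (fun x y => `[< equivalent x y >]).
Proof.
move=> y x z /asboolP xy /asboolP yz; apply/asboolP => n.
have [exy|nxy] := pselect (stream_prefix (stream x) n.+1
                           = stream_prefix (stream y) n.+1).
  by rewrite exy; exact: yz.
have [eyz|nyz] := pselect (stream_prefix (stream y) n.+1
                           = stream_prefix (stream z) n.+1).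
  by rewrite -eyz; exact: xy.
have [v [vx vy]] := xy n.+1; have [v' [v'y v'z]] := yz n.+1.
have [vx1 vy1] := incident_prefix nxy vx vy.
have [v'y1 v'z1] := incident_prefix nyz v'y v'z.
exists v; split=> //; suff -> : v = v' by [].
move: vy v'y; rewrite (stream_prefixS (stream y) n.+1) => vy v'y.
apply: (incident_once _ _ vy1 v'y1 vy v'y); first by [].
by rewrite -stream_prefixS; exact: set_valP y _.
Qed.

Definition omega_equiv : equiv_rel Omega :=
  EquivRel _ equivalent_refl equivalent_sym equivalent_trans.

Definition airplane : Type := quotient_topology {eq_quot omega_equiv}.
HB.instance Definition _ := Topological.on airplane.

Definition pt (x : Omega) : airplane := \pi_({eq_quot omega_equiv}) x.

Definition vertex_point (v : vertex) (p : airplane) : Prop :=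
  exists2 x : Omega, p = pt x &
    \forall n \near \oo, incident v (stream_prefix (stream x) n).

Definition cell (e : word) : set airplane :=
  [set pt x | x in [set x : Omega | stream_prefix (stream x) (size e) = e]].

(** * Rearrangements *)

Definition inverse_maps (f g : airplane -> airplane) : Prop :=
  cancel f g /\ cancel g f.

Definition homeomorphism (f : airplane -> airplane) : Prop :=
  continuous f /\ exists2 g, continuous g & inverse_maps f g.

Definition cellular_partition (P : seq word) : Prop :=
  [/\ all is_edge P,
      \bigcup_(e in [set` P]) cell e = setT
    & {in P &, forall e e', e <> e' -> (cell e)° `&` (cell e')° = set0}].

(* f sends the class of e w to the class of e' w, for all w *)
Definition canonical (f : airplane -> airplane) (e e' : word) : Prop :=
  forall (x y : Omega) (w : nat -> letter),
    stream x = cat_stream e w -> stream y = cat_stream e' w ->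
    f (pt x) = pt y.

Definition T_A : set (airplane -> airplane) :=
  [set f | homeomorphism f /\
    exists2 P, cellular_partition P &
      {in P, forall e, exists e', [/\ is_edge e',
         edge_colour e' = edge_colour e & canonical f e e']}].

(* Subgroups, under composition, of the group of bijections of the limit
   space. *)
Definition subgroup (H : set (airplane -> airplane)) : Prop :=
  [/\ H id,
      forall f g, H f -> H g -> H (f \o g)
    & forall f g, H f -> inverse_maps f g -> H g].

Definition commutators (G : set (airplane -> airplane)) :
    set (airplane -> airplane) :=
  [set h | exists f f' g g', [/\ G f, G g, inverse_maps f f',
     inverse_maps g g' & h = f \o g \o f' \o g']].

Definition derived_subgroup (G : set (airplane -> airplane)) :
    set (airplane -> airplane) :=
  smallest subgroup (commutators G).

(** * Components *)

(* None is the central component C_0, Some e the one determined by the blue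
   edge e. *)
Definition component : Type :=
  option {e : word | is_edge e && `[< edge_colour e = Blue >]}.

Definition component_edges (C : component) : word * word :=
  if C is Some e then (rcons (val e) u_, rcons (val e) d_)
  else ([:: e_U], [:: e_D]).

Definition boundary (C : component) : set airplane :=
  [set p | exists (x : Omega) c w, [/\ p = pt x,
     c = (component_edges C).1 \/ c = (component_edges C).2,
     stream x = cat_stream c w & forall n, w n = r_1 \/ w n = r_2]].

Definition maps_component (f : airplane -> airplane) (C C' : component) : Prop :=
  f @` boundary C = boundary C'.

Definition two_transitive_on_components (G : set (airplane -> airplane)) :
    Prop :=
  forall C1 C2 C1' C2' : component, C1 <> C2 -> C1' <> C2' ->
  exists f, [/\ G f, maps_component f C1 C1' & maps_component f C2 C2'].

(** * Graph pair diagrams *)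

(* The maps on edges and on vertices are only relevant on D and on its
   vertices. *)
Record diagram := Diagram {
  dom : set word;
  cod : set word;
  emap : word -> word;
  vmap : vertex -> vertex }.

Definition preserves_direction (phi : diagram) (e : word) : Prop :=
  initial (emap phi e) = vmap phi (initial e) /\
  terminal (emap phi e) = vmap phi (terminal e).

Definition reverses_direction (phi : diagram) (e : word) : Prop :=
  initial (emap phi e) = vmap phi (terminal e) /\
  terminal (emap phi e) = vmap phi (initial e).

Definition graph_isomorphism (phi : diagram) : Prop :=
  [/\ set_bij (dom phi) (cod phi) (emap phi),
      set_bij (vertices (dom phi)) (vertices (cod phi)) (vmap phi)
    & forall e, dom phi e -> edge_colour (emap phi e) = edge_colour e /\
        (preserves_direction phi e \/
         edge_colour e = Blue /\ reverses_direction phi e)].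

Definition flip (c : letter) : letter :=
  match c with
  | b_m => b_p | b_p => b_m | u_ => d_ | d_ => u_
  | _ => c
  end.

(* f sends the class of e c w to the class of e' (flip c) w, for all c and w *)
Definition flipped (f : airplane -> airplane) (e e' : word) : Prop :=
  forall (x y : Omega) (c : letter) (w : nat -> letter),
    stream x = cat_stream (rcons e c) w ->
    stream y = cat_stream (rcons e' (flip c)) w ->
    f (pt x) = pt y.

Definition represents (phi : diagram) (f : airplane -> airplane) : Prop :=
  [/\ expansion (dom phi), expansion (cod phi), graph_isomorphism phi
    & forall e, dom phi e ->
        (preserves_direction phi e -> canonical f e (emap phi e)) /\
        (edge_colour e = Blue -> reverses_direction phi e ->
           flipped f e (emap phi e))].

(* phi' arises from phi by expanding the edge e of its domain and the image of
   e; the images of the new vertices are then determined by those of the new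
   edges. *)
Definition expands_at (phi : diagram) (e : word) (phi' : diagram) : Prop :=
  [/\ dom phi e,
      dom phi' = replace (dom phi) e,
      cod phi' = replace (cod phi) (emap phi e),
      (forall e', dom phi e' -> e' <> e -> emap phi' e' = emap phi e') /\
      (forall v, vertices (dom phi) v -> vmap phi' v = vmap phi v)
    & forall c, c \in replacement (edge_colour e) ->
        (preserves_direction phi e ->
           emap phi' (rcons e c) = rcons (emap phi e) c) /\
        (reverses_direction phi e ->
           emap phi' (rcons e c) = rcons (emap phi e) (flip c))].

Definition reduced_diagram (phi : diagram) (f : airplane -> airplane) : Prop :=
  represents phi f /\
  forall psi e, represents psi f -> ~ expands_at psi e phi.

(** * Extremal derivatives *)

Definition radial (e : word) : bool :=
  is_edge e && (last e_U e \in [:: e_L; e_R; s_]).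

(* the set of external extremes of rays *)
Definition external_extremes : set airplane :=
  [set p | exists2 e, radial e & vertex_point (terminal e) p].

(* 1 / 2 ^ k, for k the length of the longest suffix of e in b_-, b_+ *)
Definition edge_length (e : word) : rat :=
  (2%:R ^- find (fun c => c \notin [:: b_m; b_p]) (rev e))%R.

(* D_p(f) = q, for p an external extreme of a ray *)
Definition extremal_derivative (f : airplane -> airplane) (p : airplane)
    (q : rat) : Prop :=
  exists2 phi, reduced_diagram phi f &
    ((forall v, vertices (dom phi) v -> ~ vertex_point v p) /\ q = 1%R) \/
    (exists v e, [/\ vertex_point v p, dom phi e, incident v e
       & q = (edge_length (emap phi e) / edge_length e)%R]).

Definition E_subgroup : set (airplane -> airplane) :=
  [set f | T_A f /\
    forall p, external_extremes p -> extremal_derivative f p 1%R].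

(* Main.v *)
From HB Require Import structures.
From mathcomp Require Import all_boot all_order all_algebra.
From mathcomp Require Import all_classical all_reals all_analysis.
From mathcomp Require Import zify.
Require Import Defs.

(** Five explicit rearrangements generate a group that moves every ordered pair
    of distinct components to the pair formed by the central component and the
    component of [e_R] ([reach_standard]). A component is a word, and a
    rearrangement replaces prefixes of words; suitable generators and their
    inverses make the word of a component shorter until it is [e_R]
    ([central_transitive]). Three of the generators act like elements of
    Thompson's group F on the central circle, one acts so on the right ray and
    one on the axis from [V_l] to [V_r]; the last one moves the component of
    [e_R] to the central one and the central one into the left ray.

    Passing to E. The three maps of the circle preserve the lengths of all edges
    at the external extremes. The other two, [push_ray] and [push_axis],
    preserve them except at [V_r], which they fix and where both double the
    lengths. Conjugating [push_ray] by a large power of [push_axis] gives a map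
    with the same derivative at [V_r] that is supported in a small neighbourhood
    of [V_r], hence fixes any two given components ([local_shift]). Correcting a
    generator by the inverse of such a map yields an element of E that moves the
    given pair as the generator does. So E imitates, one generator at a time,
    the path of a pair under the generated group ([moves_pair_generated]).

    Passing to the derived subgroup. Every generator [h] fixes a cell, hence two
    distinct components [C] and [C']. Given a pair [(P, Q)], the 2-transitivity
    of E, hence of T_A, gives [g] moving [(C, C')] to [(P, Q)], and the
    commutator [h \o g \o h^-1 \o g^-1] moves [(P, Q)] as [h] does. Again the
    path of a pair under the generated group is imitated step by step.

    The foundations are about diagrams. A graph isomorphism between two
    expansions, given as a set of rules on prefixes, defines a homeomorphism
    ([substitution_realize]): two words represent the same point when they run
    into a common vertex, and incidences are preserved. Conversely the images of
    the vertices are determined by the homeomorphism, because vertices are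
    points ([diagram_of_represents]), so that diagrams can be handled as bare
    sets of rules. Two diagrams are composed after a common refinement of the
    middle expansions ([rule_diagram_comp]), and conditions on lengths are
    followed through compositions, inverses and refinements. Finally,
    un-expanding a diagram keeps these conditions and lowers the number of
    edges, so a reduced diagram satisfies them ([reduced_diagram_exists]), which
    gives the extremal derivatives ([rule_diagram_E]). *)

Set Implicit Arguments.
Unset Strict Implicit.
Unset Printing Implicit Defensive.

Local Open Scope classical_set_scope.
Local Open Scope quotient_scope.

(** * Edges and their endpoints *)

Definition is_blue (e : word) : bool :=
  if edge_colour e is Blue then true else false.

Lemma is_blueP e : reflect (edge_colour e = Blue) (is_blue e).
Proof. by rewrite /is_blue; case: edge_colour; constructor. Qed.

Lemma edge_neq0 e : is_edge e -> e != [::].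
Proof. by case: e. Qed.

Lemma edge_rconsE e c : e != [::] ->
  is_edge (rcons e c) = is_edge e && (c \in replacement (edge_colour e)).
Proof. by case: e => [//|a w] _; rewrite /= rcons_path andbA. Qed.

Lemma edge_colour_rcons e c : edge_colour (rcons e c) = letter_colour c.
Proof. by rewrite /edge_colour last_rcons. Qed.

Lemma edge_catl e t : e != [::] -> is_edge (e ++ t) -> is_edge e.
Proof.
by case: e => [//|a w] _; rewrite /= cat_path => /andP[-> /andP[->]].
Qed.

Lemma edge_colour_cat e t : t != [::] -> edge_colour (e ++ t) = edge_colour t.
Proof.
by case/lastP: t => [//|t c] _; rewrite -rcons_cat !edge_colour_rcons.
Qed.

Definition vertex_code (v : vertex) : nat * word :=
  match v with
  | V_l => (0, [::]) | V_a => (1, [::]) | V_b => (2, [::]) | V_r => (3, [::])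
  | V_m e => (4, e) | V_w e => (5, e) | V_x e => (6, e) | V_y e => (7, e)
  end.

Definition vertex_decode (p : nat * word) : vertex :=
  match p.1 with
  | 0 => V_l | 1 => V_a | 2 => V_b | 3 => V_r
  | 4 => V_m p.2 | 5 => V_w p.2 | 6 => V_x p.2 | _ => V_y p.2
  end.

Lemma vertex_codeK : cancel vertex_code vertex_decode.
Proof. by case. Qed.

HB.instance Definition _ := Choice.copy vertex (can_type vertex_codeK).

(** Indexed by a boolean, so that reversing an edge adds a bit to the index. *)
Definition endpoint (e : word) (i : bool) : vertex :=
  if i then terminal e else initial e.

Lemma incidentP v e : incident v e <-> exists i, v = endpoint e i.
Proof.
split=> [[->|->]|[[] ->]]; [by exists false|by exists true|by right|by left].
Qed.

Lemma endpoint_rcons e c i : e != [::] ->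
  endpoint (rcons e c) i =
  (if i then (sub_ends e (ends e) c).2 else (sub_ends e (ends e) c).1).
Proof.
by move=> e0; rewrite /endpoint /initial /terminal ends_rcons.
Qed.

Lemma endpoint_level e i : e != [::] -> size (vertex_name (endpoint e i)) < size e.
Proof. by move=> e0; apply: incident_level => //; apply/incidentP; exists i. Qed.

(** A replacement edge joins a new vertex to another vertex, so no edge is a loop. *)
Lemma endpoint_inj e : is_edge e -> injective (endpoint e).
Proof.
suff neq : is_edge e -> initial e <> terminal e.
  by move=> /neq ee [] [] // E; case: ee; rewrite /endpoint in E.
elim/last_ind: e => [//|e c IH].
have [->|e0] := eqVneq e [::]; first by case: c.
rewrite edge_rconsE // => /andP[ee cP].
have level v i : v = endpoint e i -> vertex_name v <> e.
  by move=> -> E; have := endpoint_level i e0; rewrite E ltnn.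
rewrite /initial /terminal ends_rcons //.
case: c cP; case: (edge_colour e) => // _ /= E;
  solve [ by [] | by case: (level _ false E) | by case: (level _ true E)
        | by case: (level _ false (esym E)) | by case: (level _ true (esym E))].
Qed.

(** Replacing an edge hands its endpoints on to the new edges and creates only
    vertices that bear its own name, so a vertex with a shorter name comes from
    [e] itself. *)
Lemma incident_ancestor v e t : e != [::] -> size (vertex_name v) < size e ->
  incident v (e ++ t) -> incident v e.
Proof.
move=> e0 lv; elim/last_ind: t => [|t c IH]; first by rewrite cats0.
rewrite -rcons_cat => /incident_rcons[]; [by case: (e) e0| exact: IH|].
by move=> E; move: lv; rewrite E size_cat ltnNge leq_addr.
Qed.

(** ** Prefixes of infinite words *)

Lemma size_stream_prefix x n : size (stream_prefix x n) = n.
Proof. exact: size_mkseq. Qed.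

Lemma stream_prefix_neq0 x n : stream_prefix x n.+1 != [::].
Proof. by []. Qed.

Lemma stream_prefixD x m n :
  stream_prefix x (m + n) = stream_prefix x m ++ stream_prefix (fun k => x (m + k)) n.
Proof.
elim: n => [|n IH]; first by rewrite addn0 cats0.
by rewrite addnS !stream_prefixS IH rcons_cat.
Qed.

Lemma take_stream_prefix x m n : m <= n ->
  take m (stream_prefix x n) = stream_prefix x m.
Proof.
move=> /subnKC <-; rewrite stream_prefixD.
by rewrite -{1}(size_stream_prefix x m) take_size_cat.
Qed.

Lemma stream_prefix_inj x y : (forall n, stream_prefix x n = stream_prefix y n) -> x = y.
Proof.
move=> xy; apply: funext => n; have := xy n.+1.
by rewrite !stream_prefixS => /eqP; rewrite eqseq_rcons => /andP[_ /eqP].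
Qed.

Lemma cat_streamD e w n : cat_stream e w (size e + n) = w n.
Proof. by rewrite /cat_stream nth_default ?leq_addr // addKn. Qed.

Lemma stream_prefix_cat_stream e w : stream_prefix (cat_stream e w) (size e) = e.
Proof.
apply: (@eq_from_nth _ e_L); rewrite size_stream_prefix // => i ie.
by rewrite nth_mkseq // /cat_stream; apply: set_nth_default.
Qed.

Lemma stream_prefix_catD e w n :
  stream_prefix (cat_stream e w) (size e + n) = e ++ stream_prefix w n.
Proof.
rewrite stream_prefixD stream_prefix_cat_stream.
by congr (_ ++ stream_prefix _ _); apply: funext => k; rewrite cat_streamD.
Qed.

Lemma cat_stream_inj e : injective (cat_stream e).
Proof.
by move=> w w' E; apply: funext => n; rewrite -(cat_streamD e w) E cat_streamD.
Qed.

Lemma cat_streamE x e : stream_prefix x (size e) = e ->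
  x = cat_stream e (fun n => x (size e + n)).
Proof.
move=> xe; apply: stream_prefix_inj => n.
have [ne|/ltnW en] := leqP n (size e).
  by rewrite -!(take_stream_prefix _ ne) stream_prefix_cat_stream xe.
by rewrite -(subnKC en) stream_prefixD xe stream_prefix_catD.
Qed.

Lemma cat_stream_cat e t w : cat_stream (e ++ t) w = cat_stream e (cat_stream t w).
Proof.
apply: funext => n; rewrite /cat_stream nth_cat size_cat.
case: ltnP => // en; first exact: set_nth_default.
by rewrite [RHS]nth_default // subnDA.
Qed.

(** ** Points of Omega *)

Lemma stream_inj (x y : Omega) : stream x = stream y -> x = y.
Proof. exact: val_inj. Qed.

Lemma stream_edge (x : Omega) n : is_edge (stream_prefix (stream x) n.+1).
Proof. exact: set_valP x n. Qed.

Lemma Omega_exists s : Omega_set s -> exists x : Omega, stream x = s.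
Proof. by move=> Os; exists (SigSub (mem_set Os)). Qed.

Definition tail_ok (k : colour) (w : nat -> letter) : Prop :=
  w 0 \in replacement k /\
  forall n, w n.+1 \in replacement (letter_colour (w n)).

Lemma tail_prefix e w n : is_edge e -> tail_ok (edge_colour e) w ->
  is_edge (e ++ stream_prefix w n).
Proof.
move=> ee [w0 wS]; have e0 := edge_neq0 ee.
elim: n => [|n IH]; first by rewrite cats0.
rewrite stream_prefixS -rcons_cat edge_rconsE ?IH /=; last by case: (e) e0.
by case: n {IH} => [|n]; rewrite ?cats0 // stream_prefixS -rcons_cat edge_colour_rcons.
Qed.

Lemma Omega_cat e w : is_edge e -> tail_ok (edge_colour e) w ->
  Omega_set (cat_stream e w).
Proof.
move=> ee ew n; have e0 := edge_neq0 ee.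
have : is_edge (stream_prefix (cat_stream e w) (size e + n)).
  by rewrite stream_prefix_catD tail_prefix.
have -> : (size e + n = n.+1 + (size e).-1)%N by case: (e) e0 => //= *; lia.
rewrite stream_prefixD; exact: edge_catl.
Qed.

Lemma Omega_tail e w : e != [::] -> Omega_set (cat_stream e w) ->
  tail_ok (edge_colour e) w.
Proof.
move=> e0 O.
have en n : is_edge (e ++ stream_prefix w n).
  rewrite -stream_prefix_catD.
  by have := O (size e + n).-1; rewrite prednK // addn_gt0; case: (e) e0.
split.
  have := en 1; rewrite stream_prefixS cats1 edge_rconsE //.
  by case/andP.
move=> n; have := en n.+2; rewrite !stream_prefixS -!rcons_cat edge_rconsE.
  by rewrite edge_colour_rcons => /andP[].
by rewrite -size_eq0 size_rcons.
Qed.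

(** ** Equivalence of infinite words *)

Lemma incident_descend x y n v : stream_prefix x n.+1 <> stream_prefix y n.+1 ->
  forall m, incident v (stream_prefix x (n.+1 + m)) ->
  incident v (stream_prefix y (n.+1 + m)) ->
  incident v (stream_prefix x n.+1) /\ incident v (stream_prefix y n.+1).
Proof.
move=> neq; elim=> [|m IH]; first by rewrite addn0.
rewrite addnS => vx vy.
have neq' : stream_prefix x (n + m).+1 <> stream_prefix y (n + m).+1.
  move=> E; apply: neq.
  by rewrite -(@take_stream_prefix x _ (n + m).+1) ?E ?take_stream_prefix //; lia.
by have [] := incident_prefix neq' vx vy; exact: IH.
Qed.

(** A vertex shared at a deep level is also shared at every shallower level at
    which the two words already differ. *)
Lemma equivalent_cofinal (x y : Omega) :
  (forall N, exists2 n, N <= n & exists v, incident v (stream_prefix (stream x) n) /\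
                      incident v (stream_prefix (stream y) n)) ->
  equivalent x y.
Proof.
move=> H n.
have [E|neq] := pselect (stream_prefix (stream x) n.+1 = stream_prefix (stream y) n.+1).
  by rewrite -E; exists (initial (stream_prefix (stream x) n.+1)); split; left.
have [m nm [v [vx vy]]] := H n.+1; exists v.
rewrite -(subnKC nm) in vx vy; exact: incident_descend neq _ vx vy.
Qed.

(** Two different equivalent words meet along one vertex: it is the vertex
    shared by all their prefixes, and it stops changing because two consecutive
    edges of a word have only one common vertex. *)
Lemma equivalent_vertex (x y : Omega) : equivalent x y -> x <> y ->
  exists v N, forall n, N <= n -> incident v (stream_prefix (stream x) n) /\
                                 incident v (stream_prefix (stream y) n).
Proof.
move=> xy nxy.
have [N neqN] : exists N, stream_prefix (stream x) N <> stream_prefix (stream y) N.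
  apply: contrapT => E; apply/nxy/stream_inj/stream_prefix_inj => n.
  by apply: contrapT => ?; apply: E; exists n.
have neq n : N <= n -> stream_prefix (stream x) n <> stream_prefix (stream y) n.
  move=> Nn E; apply: neqN.
  by rewrite -(take_stream_prefix (stream x) Nn) E take_stream_prefix.
have desc u k m : incident u (stream_prefix (stream x) (N.+1 + k + m)) ->
   incident u (stream_prefix (stream y) (N.+1 + k + m)) ->
   incident u (stream_prefix (stream x) (N.+1 + k)).
  rewrite addSn => ux uy; apply: (proj1 (incident_descend _ ux uy)).
  by apply: neq; rewrite -addSn ltnW ?leq_addr.
have [v [vx vy]] := xy N.+1; exists v, N.+2 => n Nn.
suff: incident v (stream_prefix (stream x) (N.+1 + (n - N.+1))) /\
      incident v (stream_prefix (stream y) (N.+1 + (n - N.+1))).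
  by rewrite subnKC // ltnW.
have [u [ux uy]] := xy n.-1; move: ux uy.
have -> : n.-1.+1 = (N.+1 + (n - N.+1))%N by lia.
move=> ux uy; suff -> : v = u by [].
have v1 : incident v (stream_prefix (stream x) (N.+1 + 0)).
  by apply: (desc v 0 1); rewrite addn0 addn1.
have u1 : incident u (stream_prefix (stream x) (N.+1 + 0)).
  by apply: (desc u 0 (n - N.+1)); rewrite addn0.
have u2 : incident u (stream_prefix (stream x) (N.+1 + 1)).
  apply: (desc u 1 (n - N.+2)).
    by have -> : (N.+1 + 1 + (n - N.+2) = N.+1 + (n - N.+1))%N by lia.
  by have -> : (N.+1 + 1 + (n - N.+2) = N.+1 + (n - N.+1))%N by lia.
rewrite addn0 in v1 u1; rewrite addn1 stream_prefixS in u2; rewrite stream_prefixS in vx.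
apply: (incident_once _ _ v1 u1 vx u2) => //.
by rewrite -stream_prefixS; exact: stream_edge.
Qed.

(** ** Points of the limit space *)

Lemma ptP (x y : Omega) : pt x = pt y <-> equivalent x y.
Proof.
split=> [/eqmodP/asboolP //|xy].
by apply/eqmodP/asboolP.
Qed.

Lemma pt_surj (p : airplane) : exists x, p = pt x.
Proof. by exists (repr p); rewrite /pt reprK. Qed.

Definition eventually_incident (v : vertex) (s : nat -> letter) : Prop :=
  exists N, forall n, N <= n -> incident v (stream_prefix s n).

Lemma eventually_incident_uniq (x : Omega) v v' :
  eventually_incident v (stream x) -> eventually_incident v' (stream x) -> v = v'.
Proof.
move=> [N vN] [N' vN']; pose n := (maxn N N').+1.
have e0 := stream_prefix_neq0 (stream x) (maxn N N').
apply: (incident_once e0 _ (vN n _) (vN' n _) _ _ (c := stream x n)).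
- by rewrite -stream_prefixS; exact: stream_edge.
- by rewrite /n leqW ?leq_maxl.
- by rewrite /n leqW ?leq_maxr.
- by rewrite -stream_prefixS; apply: vN; rewrite /n !leqW ?leq_maxl.
- by rewrite -stream_prefixS; apply: vN'; rewrite /n !leqW ?leq_maxr.
Qed.

Lemma eventually_incident_pt (x y : Omega) v :
  eventually_incident v (stream x) -> eventually_incident v (stream y) -> pt x = pt y.
Proof.
move=> [N vN] [N' vN']; apply/ptP/equivalent_cofinal => M.
exists (maxn M (maxn N N')); first by rewrite leq_maxl.
by exists v; split; [apply: vN|apply: vN']; rewrite !leq_max leqnn !orbT.
Qed.

(** The fibres of [pt] are the words through a vertex, and singletons. *)
Lemma pt_eq_vertex (x y : Omega) : pt x = pt y -> x <> y ->
  exists v, eventually_incident v (stream x) /\ eventually_incident v (stream y).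
Proof.
move=> /ptP xy nxy; have [v [N H]] := equivalent_vertex xy nxy.
by exists v; split; exists N => n /H[].
Qed.

Lemma vertex_pointP v p :
  vertex_point v p <-> exists2 x, p = pt x & eventually_incident v (stream x).
Proof.
split=> -[x -> H]; exists x => //; first by case: H => N _ H; exists N => n; exact: H.
by case: H => N H; exists N.
Qed.

Lemma vertex_point_vertex v v' p : vertex_point v p -> vertex_point v' p -> v = v'.
Proof.
move=> /vertex_pointP[x -> vx] /vertex_pointP[y xy vy].
have [E|nxy] := pselect (x = y).
  by rewrite -E in vy; exact: eventually_incident_uniq vx vy.
have [u [ux uy]] := pt_eq_vertex xy nxy.
by rewrite (eventually_incident_uniq vx ux) (eventually_incident_uniq uy vy).
Qed.

Lemma vertex_point_pt v p q : vertex_point v p -> vertex_point v q -> p = q.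
Proof.
by move=> /vertex_pointP[x -> vx] /vertex_pointP[y -> vy]; exact: eventually_incident_pt vx vy.
Qed.

(** Words ending in an alternation of [r_1] and [r_2] run into no vertex, so
    they are alone in their class. *)
Definition zigzag (k : colour) (n : nat) : letter :=
  match k, n with
  | Blue, 0 => u_
  | Blue, n.+1 => if odd n then r_2 else r_1
  | Red, n => if odd n then r_2 else r_1
  end.

Lemma zigzag_ok k : tail_ok k (zigzag k).
Proof.
split=> [|n]; first by case: k.
case: k => /=; first by case: (odd n).
by case: n => [|n] //=; case: (odd n).
Qed.

Lemma red_corner e v : is_edge e -> edge_colour e = Red ->
  incident v e -> incident v (rcons e r_1) -> incident v (rcons (rcons e r_1) r_2) ->
  False.
Proof.
move=> ee er ve ve1 ve12; have e0 := edge_neq0 ee.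
have vm : v <> V_m e.
  by move=> E; have := incident_level e0 ve; rewrite E ltnn.
have vm1 : v <> V_m (rcons e r_1).
  by move=> E; have := incident_level e0 ve; rewrite E /= size_rcons; lia.
move: ve12; rewrite /incident /initial /terminal ends_rcons -?size_eq0 ?size_rcons //.
by rewrite ends_rcons //= => -[].
Qed.

Lemma zigzag_no_vertex e v : is_edge e ->
  ~ eventually_incident v (cat_stream e (zigzag (edge_colour e))).
Proof.
move=> ee [N vN]; have e0 := edge_neq0 ee.
pose m := (if is_blue e then N.*2.+1 else N.*2).
pose s := stream_prefix (cat_stream e (zigzag (edge_colour e))).
have mN : N <= m by rewrite /m -addnn; case: ifP => _; lia.
have sE : s (size e + m.+1) = rcons (s (size e + m)) r_1.
  rewrite /s addnS stream_prefixS cat_streamD; congr (rcons _ _).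
  by rewrite /m /is_blue; case: edge_colour => /=; rewrite odd_double.
have sE2 : s (size e + m.+2) = rcons (rcons (s (size e + m)) r_1) r_2.
  rewrite -sE /s addnS stream_prefixS cat_streamD; congr (rcons _ _).
  by rewrite /m /is_blue; case: edge_colour => /=; rewrite odd_double.
have es : is_edge (s (size e + m)).
  by rewrite /s stream_prefix_catD; apply: tail_prefix => //; exact: zigzag_ok.
have rs : edge_colour (s (size e + m)) = Red.
  have: is_edge (s (size e + m.+1)).
    by rewrite /s stream_prefix_catD; apply: tail_prefix => //; exact: zigzag_ok.
  rewrite sE edge_rconsE ?edge_neq0 // => /andP[_].
  by case: edge_colour.
apply: (red_corner (v := v) es rs); rewrite -?sE2 -?sE; apply: vN; lia.
Qed.

Lemma zigzag_class (x y : Omega) e : is_edge e ->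
  stream x = cat_stream e (zigzag (edge_colour e)) -> pt x = pt y -> x = y.
Proof.
move=> ee xE xy; apply: contrapT => nxy.
have [v [vx _]] := pt_eq_vertex xy nxy; rewrite xE in vx.
exact: zigzag_no_vertex vx.
Qed.

(** The infinite words that run into an endpoint of an edge of colour [k]. *)
Definition end_tail (k : colour) (i : bool) (n : nat) : letter :=
  match k with
  | Red => if i then r_2 else r_1
  | Blue => if n is 0 then (if i then b_p else b_m) else b_p
  end.

Lemma end_tail_ok k i : tail_ok k (end_tail k i).
Proof. by split=> [|n]; case: k; case: i => //=; case: n. Qed.

Lemma end_tail_incident e i : is_edge e ->
  eventually_incident (endpoint e i) (cat_stream e (end_tail (edge_colour e) i)).
Proof.
move=> ee; have e0 := edge_neq0 ee.
pose j := if is_blue e then true else i.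
suff H n : endpoint (e ++ stream_prefix (end_tail (edge_colour e) i) n.+1) j
           = endpoint e i.
  exists (size e).+1 => n en; apply/incidentP; exists j.
  have -> : n = (size e + (n - size e).-1.+1)%N by lia.
  by rewrite stream_prefix_catD H.
elim: n => [|n IH].
  rewrite stream_prefixS cats1 endpoint_rcons // /j /is_blue {j}.
  by case: edge_colour; case: i.
rewrite stream_prefixS -rcons_cat endpoint_rcons; last by case: (e) e0.
by move: IH; rewrite /endpoint /initial /terminal /j /is_blue {j}; case: edge_colour; case: i.
Qed.

Lemma endpoint_point e i (x : Omega) : is_edge e ->
  stream x = cat_stream e (end_tail (edge_colour e) i) -> vertex_point (endpoint e i) (pt x).
Proof.
by move=> ee xE; apply/vertex_pointP; exists x; rewrite // xE; exact: end_tail_incident.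
Qed.

(** * Topology of the limit space *)

Definition agree (n : nat) (x y : Omega) : Prop :=
  stream_prefix (stream x) n = stream_prefix (stream y) n.

Lemma nbhs_streams (s : letter_streams) (A : set letter_streams) :
  nbhs s A -> exists N, forall t, stream_prefix s N = stream_prefix t N -> A t.
Proof.
pose F := filter_from [set: nat] (fun N => [set t : letter_streams |
  stream_prefix s N = stream_prefix t N]).
have FF : Filter F.
  apply: filter_from_filter; first by exists 0.
  move=> i j _ _; exists (maxn i j) => // t /= E; split=> /=.
    rewrite -(@take_stream_prefix s i (maxn i j)) ?leq_maxl // E.
    by rewrite take_stream_prefix ?leq_maxl.
  rewrite -(@take_stream_prefix s j (maxn i j)) ?leq_maxr // E.
  by rewrite take_stream_prefix ?leq_maxr.
have cF : F --> (s : letter_streams).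
  apply/cvg_sup => i B [C [[D oD D0] Ds] sub].
  exists i.+1 => // t /= E; apply: sub; rewrite -D0.
  suff ts : t i = s i by move: Ds; rewrite -D0 /= /proj ts.
  by move: E; rewrite !stream_prefixS => /eqP; rewrite eqseq_rcons => /andP[_ /eqP].
by move=> /cF [N _ H]; exists N => t; exact: H.
Qed.

Lemma letter_open (n : nat) (c : letter) :
  open ([set t | t n = c] : set letter_streams).
Proof.
have H : continuous (fun t : letter_streams => t n : discrete_topology letter).
  exact: (@proj_continuous nat (fun _ => discrete_topology letter) n).
by have := (continuousP _).1 H [set c]; apply; exact: discrete_open.
Qed.

Lemma prefix_open (s : letter_streams) N :
  open ([set t | stream_prefix s N = stream_prefix t N] : set letter_streams).
Proof.
elim: N => [|N IH]; first by rewrite (_ : [set t | _] = setT) //; [exact: openT|exact/seteqP].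
have -> : [set t : letter_streams | stream_prefix s N.+1 = stream_prefix t N.+1] =
  [set t : letter_streams | stream_prefix s N = stream_prefix t N] `&` [set t : letter_streams | t N = s N].
  apply/seteqP; split=> t /=; rewrite !stream_prefixS.
    by move=> /eqP; rewrite eqseq_rcons => /andP[/eqP -> /eqP ->].
  by move=> [-> ->].
by apply: openI => //; exact: letter_open.
Qed.

Lemma open_OmegaP (U : set Omega) :
  open U <-> forall x, U x -> exists N, forall y, agree N x y -> U y.
Proof.
split=> [[B oB <-] x Bx|H].
  have /nbhs_streams[N HN] : nbhs (set_val x : letter_streams) B.
    by apply: open_nbhs_nbhs.
  by exists N => y; exact: HN.
pose B := \bigcup_(p in [set p : Omega * nat | forall y, agree p.2 p.1 y -> U y])
  [set t : letter_streams | stream_prefix (stream p.1) p.2 = stream_prefix t p.2].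
exists B; first by apply: bigcup_open => p _; exact: prefix_open.
apply/seteqP; split=> [x [p Hp Ep]|x Ux] /=; first exact: (Hp x).
by have [N HN] := H x Ux; exists (x, N).
Qed.

Lemma open_airplaneP (U : set airplane) :
  open U <-> forall x, U (pt x) -> exists N, forall y, agree N x y -> U (pt y).
Proof. exact: (open_OmegaP (pt @^-1` U)). Qed.

(** The words that agree with a given one up to some level form a basis of
    neighbourhoods, and the open sets of the limit space are those that pull
    back to open sets of words. *)
Lemma continuous_induced (f : airplane -> airplane) (g : Omega -> Omega) :
  (forall x, f (pt x) = pt (g x)) ->
  (forall x n, exists N, forall y, agree N x y -> agree n (g x) (g y)) ->
  continuous f.
Proof.
move=> fg gc; apply/continuousP => U /open_airplaneP oU; apply/open_airplaneP => x /=.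
rewrite fg => /oU[n Hn]; have [N HN] := gc x n.
by exists N => y /HN /Hn; rewrite /= fg.
Qed.

(** ** Prefix codes *)

(** Finite words that cut every infinite word in exactly one place; the edges of
    an expansion are an example. *)
Definition prefix_code (D : set word) : Prop :=
  [/\ forall e, D e -> is_edge e,
      forall e t, D e -> D (e ++ t) -> t = [::]
    & forall x : Omega, exists2 e, D e & stream_prefix (stream x) (size e) = e].

Lemma prefix_code_uniq D (x : Omega) e e' : prefix_code D -> D e -> D e' ->
  stream_prefix (stream x) (size e) = e -> stream_prefix (stream x) (size e') = e' ->
  e = e'.
Proof.
move=> [_ anti _]; wlog le : e e' / size e <= size e'.
  by move=> W De De' xe xe'; case: (leqP (size e) (size e')) => [|/ltnW] le;
    [|symmetry]; apply: W.
move=> De De' xe xe'.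
have E : e' = e ++ drop (size e) e'.
  by rewrite -{1}(cat_take_drop (size e) e') -{1}xe' take_stream_prefix // xe.
have t0 : drop (size e) e' = [::] by apply: (anti e) => //; rewrite -E.
by rewrite E t0 cats0.
Qed.

(** Cells of a prefix code overlap only along vertices, and no nonempty open set
    consists of vertices, because any prefix continues into a zigzag. *)
Lemma cell_interiors_disjoint D e e' : prefix_code D -> D e -> D e' -> e <> e' ->
  (cell e)° `&` (cell e')° = set0.
Proof.
move=> cD De De' ne; apply/seteqP; split=> // p [pe pe'].
have [U [[oU Up] sU]] : exists U, open_nbhs p U /\ U `<=` cell e `&` cell e'.
  exists ((cell e)° `&` (cell e')°); split.
    by split=> //; apply: openI; exact: open_interior.
  by move=> q [/interior_subset qe /interior_subset qe'].
have [x px] := pt_surj p; subst p.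
have [N HN] := (open_airplaneP U).1 oU x Up.
pose a := stream_prefix (stream x) N.+1.
have ea : is_edge a by exact: stream_edge.
have [z zE] := Omega_exists (Omega_cat ea (zigzag_ok _)).
have /sU[[y /= ye yz] [y' /= ye' y'z]] : U (pt z).
  have Na : N <= size a by rewrite size_stream_prefix.
  apply: HN; rewrite /agree zE -[RHS](take_stream_prefix _ Na).
  by rewrite stream_prefix_cat_stream take_stream_prefix.
have zy := zigzag_class ea zE (esym yz); have zy' := zigzag_class ea zE (esym y'z).
by apply/ne/(prefix_code_uniq (x := z) cD De De'); [rewrite zy|rewrite zy'].
Qed.

(** * Expansions *)

Lemma prefix_code_edge D e : prefix_code D -> D e -> is_edge e.
Proof. by case=> H _ _; exact: H. Qed.

Lemma prefix_code_rcons D e c : prefix_code D -> D e -> ~ D (rcons e c).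
Proof. by move=> [_ anti _] De; rewrite -cats1 => /(anti _ _ De). Qed.

Lemma replace_code D e : prefix_code D -> D e -> prefix_code (replace D e).
Proof.
move=> cD De; have [edD anti cover] := cD; have ee := edD _ De; split.
- move=> a [[Da _]|[c cP <-]]; first exact: edD.
  by rewrite edge_rconsE ?edge_neq0 // ee.
- move=> a t [[Da nae]|[c cP <-]] [[Dat nate]|[c' cP' E]].
  + exact: anti Dat.
  + case/lastP: t E => [//|t c''] /eqP; rewrite -rcons_cat eqseq_rcons => /andP[/eqP E _].
    by case: nae => /=; rewrite E (anti a t Da) ?cats0 -?E.
  + by move: Dat; rewrite cat_rcons => /(anti _ _ De).
  + move/(congr1 size)/eqP: E; rewrite size_cat !size_rcons.
    by rewrite -{1}[(size e).+1]addn0 eqn_add2l eq_sym size_eq0 => /eqP.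
- move=> x; have [a Da xa] := cover x.
  have [ae|nae] := pselect (a = e); last by exists a => //; left.
  exists (rcons e (stream x (size e))); last by rewrite size_rcons stream_prefixS -ae xa.
  right; exists (stream x (size e)) => //=; have := stream_edge x (size e).
  by rewrite stream_prefixS -ae xa ae edge_rconsE ?edge_neq0 // => /andP[].
Qed.

Lemma expansion_code D : expansion D -> prefix_code D.
Proof.
elim=> [|{}D e _ cD De]; last exact: replace_code.
split=> [e /=|e t /=|x].
- by rewrite !inE => /or4P[] /eqP ->.
- by rewrite !inE => /or4P[] /eqP -> /=; case: t => // c t /or4P[] /eqP.
- exists (stream_prefix (stream x) 1); last by rewrite size_stream_prefix.
  by have := stream_edge x 0; rewrite /stream_prefix /mkseq /= andbT !inE; case: (stream x 0).
Qed.

Lemma expansion_seq D : expansion D -> exists2 l : seq word, uniq l & D = [set` l].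
Proof.
elim=> [|{}D e _ [l ul ->] De]; first by eexists; last by [].
exists (undup ([seq a <- l | a != e] ++ [seq rcons e c | c <- replacement (edge_colour e)])).
  exact: undup_uniq.
apply/seteqP; split=> a /=; rewrite mem_undup mem_cat mem_filter.
  case=> [[/= al /eqP nae]|[c cP <-]]; first by rewrite nae al.
  by rewrite (map_f (rcons e) cP) orbT.
by case/orP => [/andP[/eqP nae al]|/mapP[c cP ->]]; [left|right; exists c].
Qed.

Inductive refines (D : set word) : set word -> Prop :=
| refines_refl : refines D D
| refines_replace X e : refines D X -> X e -> refines D (replace X e).

Lemma refines_code D X : prefix_code D -> refines D X -> prefix_code X.
Proof. by move=> cD; elim=> [//|{}X e _ cX Xe]; exact: replace_code. Qed.

Lemma expansion_refines D : expansion D ->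
  refines [set` [:: [:: e_L]; [:: e_R]; [:: e_U]; [:: e_D]]] D.
Proof. by elim=> [|{}D e _ IH De]; [exact: refines_refl|exact: refines_replace]. Qed.

Lemma replaceC D e e' : prefix_code D -> D e -> D e' -> e <> e' ->
  replace (replace D e) e' = replace (replace D e') e.
Proof.
move=> cD De De' ne.
suff E a b : D a -> D b -> a <> b ->
    replace (replace D a) b = ((D `\ a) `\ b) `|` (subedges a `|` subedges b).
  by rewrite !E // 1?eq_sym; [rewrite setUC (setUC (subedges e)) setDDl setDDl (setUC [set e]) setUC|move=> /esym].
move=> Da Db nab; rewrite /replace setDUl -setUA; congr (_ `|` (_ `|` _)).
apply/seteqP; split=> [x []//|x sx]; split=> //= xb; subst x.
by case: sx => c cP E; move: Db; rewrite -E; exact: prefix_code_rcons.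
Qed.

Lemma refines_diamond D X e : prefix_code D -> D e -> refines D X ->
  refines (replace D e) X \/ (X e /\ refines (replace D e) (replace X e)).
Proof.
move=> cD De; elim=> [|{}X a DX IH Xa]; first by right; split=> //; exact: refines_refl.
case: IH => [H|[Xe H]]; first by left; exact: refines_replace.
have [->|nae] := pselect (a = e); first by left.
right; split; first by left; split=> // /esym.
rewrite replaceC //; last exact: refines_code DX.
by apply: refines_replace => //; left; split.
Qed.

(** Replacements of different edges commute, so two refinements can be merged one
    replacement at a time. *)
Lemma refines_confluent D X Y : prefix_code D -> refines D X -> refines D Y ->
  exists2 Z, refines X Z & refines Y Z.
Proof.
move=> cD DX DY; elim: DX => [|{}X e DX [Z XZ YZ] Xe].
  by exists Y => //; exact: refines_refl.
have [XeZ|[Ze XeZ]] := refines_diamond (refines_code cD DX) Xe XZ; first by exists Z.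
by exists (replace Z e) => //; exact: refines_replace.
Qed.

(** * Diagrams as sets of substitution rules *)

Definition turn (b : bool) (c : letter) : letter := if b then flip c else c.

Definition turn_word (b : bool) (t : word) : word :=
  if t is c :: t' then turn b c :: t' else [::].

Definition turn_stream (b : bool) (w : nat -> letter) (n : nat) : letter :=
  if n is 0 then turn b (w 0) else w n.

Lemma turnD b b' c : turn b' (turn b c) = turn (b (+) b') c.
Proof. by case: b; case: b'; case: c. Qed.

Lemma turn_colour b c : letter_colour (turn b c) = letter_colour c.
Proof. by case: b; case: c. Qed.

Lemma turn_replacement (b : bool) k c : (b -> k = Blue) ->
  (turn b c \in replacement k) = (c \in replacement k).
Proof. by case: b => [->|_] //; case: c. Qed.

Lemma turn_streamD b b' w : turn_stream b' (turn_stream b w) = turn_stream (b (+) b') w.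
Proof. by apply: funext => -[|n] //=; rewrite turnD. Qed.

Lemma turn_stream0 w : turn_stream false w = w.
Proof. by apply: funext => -[]. Qed.

Lemma turn_stream_prefix b w n :
  stream_prefix (turn_stream b w) n = turn_word b (stream_prefix w n).
Proof.
elim: n => [//|n IH]; rewrite !stream_prefixS IH.
by case: n {IH} => [//|n]; rewrite -[n.+1]add1n stream_prefixD.
Qed.

Lemma turn_stream_ok (b : bool) k w : (b -> k = Blue) -> tail_ok k w -> tail_ok k (turn_stream b w).
Proof.
move=> bk [w0 wS]; split=> [|[|n]] /=; rewrite ?turn_replacement ?turn_colour //.
Qed.

(** A rule [(e, e', b)] maps the cell of [e] to the cell of [e'], turning the
    first replacement letter around when [b] holds. *)
Definition rule : Type := (word * word * bool)%type.
Definition src (r : rule) : word := r.1.1.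
Definition dst (r : rule) : word := r.1.2.
Definition turned (r : rule) : bool := r.2.
Definition inv_rule (r : rule) : rule := (dst r, src r, turned r).
Definition comp_rule (r s : rule) : rule := (src r, dst s, turned r (+) turned s).
Definition sub_rule (r : rule) (c : letter) : rule :=
  (rcons (src r) c, rcons (dst r) (turn (turned r) c), false).

Lemma src_sub r c : src (sub_rule r c) = rcons (src r) c. Proof. by []. Qed.
Lemma dst_sub r c : dst (sub_rule r c) = rcons (dst r) (turn (turned r) c).
Proof. by []. Qed.

Definition carries (f : airplane -> airplane) (r : rule) : Prop :=
  forall (x y : Omega) w, stream x = cat_stream (src r) w ->
    stream y = cat_stream (dst r) (turn_stream (turned r) w) -> f (pt x) = pt y.

Definition coloured (r : rule) : Prop :=
  edge_colour (dst r) = edge_colour (src r) /\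
  (turned r -> edge_colour (src r) = Blue).

Lemma inv_coloured r : coloured r -> coloured (inv_rule r).
Proof. by move=> [E b]; split=> //= /b; rewrite E. Qed.

Lemma sub_coloured r c : coloured (sub_rule r c).
Proof. by split=> //=; rewrite !edge_colour_rcons turn_colour. Qed.

Lemma carries_sub f r c : carries f r -> carries f (sub_rule r c).
Proof.
move=> fr x y w; rewrite turn_stream0 src_sub dst_sub -!cats1 !cat_stream_cat => xE yE.
apply: fr xE _; rewrite yE; congr cat_stream; apply: funext => -[|n] //=.

Qed.

Lemma carries_inv f g r : inverse_maps f g -> carries f r -> carries g (inv_rule r).
Proof.
move=> [fK _] fr x y w xE yE; rewrite -(fK (pt y)); congr g; symmetry.
by apply: fr yE _; rewrite turn_streamD addbb turn_stream0.
Qed.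

Lemma carries_comp f g r s : is_edge (src r) -> is_edge (dst r) -> coloured r ->
  dst r = src s -> carries f r -> carries g s -> carries (g \o f) (comp_rule r s).
Proof.
move=> er er' [cr br] rs fr gs x y w xE yE /=.
have Ow : tail_ok (edge_colour (src r)) w.
  by apply: Omega_tail; rewrite ?edge_neq0 // -xE; exact: set_valP x.
have [z zE] : exists z : Omega, stream z = cat_stream (dst r) (turn_stream (turned r) w).
  by apply/Omega_exists/Omega_cat => //; rewrite cr; exact: turn_stream_ok.
by rewrite (fr x z w xE zE); apply: gs; rewrite -?rs ?zE // turn_streamD.
Qed.

(** A diagram for [f] all of whose rules satisfy [W]; the maps on vertices are
    left out, because the map [f] determines them. *)
Record rule_diagram (W : rule -> Prop) (f : airplane -> airplane) (Q : set rule) :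
    Prop := RuleDiagram {
  rd_src : expansion (src @` Q);
  rd_dst : expansion (dst @` Q);
  rd_src_inj : forall r s, Q r -> Q s -> src r = src s -> r = s;
  rd_dst_inj : forall r s, Q r -> Q s -> dst r = dst s -> r = s;
  rd_rule : forall r, Q r -> [/\ coloured r, carries f r & W r] }.

Section RuleDiagrams.
Variables (W : rule -> Prop) (f : airplane -> airplane).

Lemma rd_src_edge Q r : rule_diagram W f Q -> Q r -> is_edge (src r).
Proof. by move=> d Qr; apply: (prefix_code_edge (expansion_code (rd_src d))); exists r. Qed.

Lemma rd_dst_edge Q r : rule_diagram W f Q -> Q r -> is_edge (dst r).
Proof. by move=> d Qr; apply: (prefix_code_edge (expansion_code (rd_dst d))); exists r. Qed.

Definition refine_rules (Q : set rule) (r : rule) : set rule :=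
  (Q `\ r) `|` [set sub_rule r c | c in [set` replacement (edge_colour (src r))]].

Lemma refine_src Q r : rule_diagram W f Q -> Q r ->
  src @` refine_rules Q r = replace (src @` Q) (src r).
Proof.
move=> d Qr; rewrite /refine_rules image_setU; congr (_ `|` _).
  apply/seteqP; split=> [_ [s [Qs ns] <-]|_ [[s Qs <-] ns]].
    by split; [exists s|move=> /= E; apply: ns; exact: rd_src_inj d _ _ Qs Qr E].
  by exists s => //; split=> // E; apply: ns; rewrite E.
by apply/seteqP; split=> [_ [_ [c cP <-] <-]|_ [c cP <-]]; [exists c|exists (sub_rule r c) => //; exists c].
Qed.

Lemma refine_dst Q r : rule_diagram W f Q -> Q r ->
  dst @` refine_rules Q r = replace (dst @` Q) (dst r).
Proof.
move=> d Qr; have [[cr br] _ _] := rd_rule d Qr.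
rewrite /refine_rules image_setU; congr (_ `|` _).
  apply/seteqP; split=> [_ [s [Qs ns] <-]|_ [[s Qs <-] ns]].
    by split; [exists s|move=> /= E; apply: ns; exact: rd_dst_inj d _ _ Qs Qr E].
  by exists s => //; split=> // E; apply: ns; rewrite E.
apply/seteqP; split=> [_ [_ [c /= cP <-] <-]|_ [c /= cP <-]].
  by exists (turn (turned r) c) => //=; rewrite cr turn_replacement.
exists (sub_rule r (turn (turned r) c)); last by rewrite /dst /= turnD addbb.
by exists (turn (turned r) c) => //=; rewrite turn_replacement // -cr.
Qed.

Definition stable : Prop := forall r c, is_edge (src r) -> is_edge (dst r) -> coloured r -> W r ->
  c \in replacement (edge_colour (src r)) -> W (sub_rule r c).

Hypothesis stableW : stable.

Lemma rule_diagram_refine Q r : rule_diagram W f Q -> Q r ->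
  rule_diagram W f (refine_rules Q r).
Proof.
move=> d Qr; have [rok fr Wr] := rd_rule d Qr.
have src_new s c : Q s -> src s <> rcons (src r) c.
  move=> Qs E; apply: (prefix_code_rcons (expansion_code (rd_src d)) (e := src r) (c := c)).
    by exists r.
  by exists s.
have dst_new s c : Q s -> dst s <> rcons (dst r) c.
  move=> Qs E; apply: (prefix_code_rcons (expansion_code (rd_dst d)) (e := dst r) (c := c)).
    by exists r.
  by exists s.
split.
- rewrite refine_src //; apply: expansion_replace; [exact: rd_src d|by exists r].
- rewrite refine_dst //; apply: expansion_replace; [exact: rd_dst d|by exists r].
- move=> s s' [[Qs _]|[c cP <-]] [[Qs' _]|[c' cP' <-]].
  + exact: rd_src_inj d _ _ Qs Qs'.
  + by move/src_new => /(_ Qs).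
  + by move/esym/src_new => /(_ Qs').
  + by move=> /eqP; rewrite eqseq_rcons => /andP[_ /eqP ->].
- move=> s s' [[Qs _]|[c cP <-]] [[Qs' _]|[c' cP' <-]].
  + exact: rd_dst_inj d _ _ Qs Qs'.
  + by move/dst_new => /(_ Qs).
  + by move/esym/dst_new => /(_ Qs').
  + move=> /eqP; rewrite eqseq_rcons => /andP[_ /eqP /(congr1 (turn (turned r)))].
    by rewrite !turnD addbb /turn => ->.
- move=> s [[Qs _]|[c cP <-]]; first exact: (rd_rule d Qs).
  split; [exact: sub_coloured|exact: carries_sub|].
  by apply: stableW => //; [exact: rd_src_edge d Qr|exact: rd_dst_edge d Qr].
Qed.

Lemma rule_diagram_src Q Z : rule_diagram W f Q -> refines (src @` Q) Z ->
  exists2 Q', rule_diagram W f Q' & src @` Q' = Z.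
Proof.
move=> d; elim=> [|X e _ [Q' d' <-] [r Q'r <-]]; first by exists Q.
by exists (refine_rules Q' r); [exact: rule_diagram_refine|exact: refine_src].
Qed.

Lemma rule_diagram_dst Q Z : rule_diagram W f Q -> refines (dst @` Q) Z ->
  exists2 Q', rule_diagram W f Q' & dst @` Q' = Z.
Proof.
move=> d; elim=> [|X e _ [Q' d' <-] [r Q'r <-]]; first by exists Q.
by exists (refine_rules Q' r); [exact: rule_diagram_refine|exact: refine_dst].
Qed.

End RuleDiagrams.

Lemma rule_diagram_inv W W' f g Q : inverse_maps f g ->
  (forall r, coloured r -> W r -> W' (inv_rule r)) ->
  rule_diagram W f Q -> rule_diagram W' g (inv_rule @` Q).
Proof.
move=> fg WW' d.
have E1 : src @` (inv_rule @` Q) = dst @` Q by rewrite image_comp.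
have E2 : dst @` (inv_rule @` Q) = src @` Q by rewrite image_comp.
split.
- by rewrite E1; exact: rd_dst d.
- by rewrite E2; exact: rd_src d.
- by move=> _ _ [r Qr <-] [s Qs <-] E; congr inv_rule; exact: rd_dst_inj d _ _ Qr Qs E.
- by move=> _ _ [r Qr <-] [s Qs <-] E; congr inv_rule; exact: rd_src_inj d _ _ Qr Qs E.
- move=> _ [r Qr <-]; have [rok fr Wr] := rd_rule d Qr.
  by split; [exact: inv_coloured|exact: carries_inv fg fr|exact: WW'].
Qed.

(** Two diagrams compose after refining them until the range of one is the
    domain of the other. *)
Lemma rule_diagram_comp W1 W2 W f g Q P :
  stable W1 -> stable W2 ->
  (forall r s, coloured r -> coloured s -> dst r = src s -> W1 r -> W2 s -> W (comp_rule r s)) ->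
  rule_diagram W1 f Q -> rule_diagram W2 g P ->
  exists T, rule_diagram W (g \o f) T.
Proof.
move=> st1 st2 W12 dQ dP.
have [Z QZ PZ] := refines_confluent (expansion_code (expansion_base))
  (expansion_refines (rd_dst dQ)) (expansion_refines (rd_src dP)).
have [Q' dQ' QE] := rule_diagram_dst st1 dQ QZ.
have [P' dP' PE] := rule_diagram_src st2 dP PZ.
clear Q P dQ dP QZ PZ; move: Q' P' dQ' dP' QE PE => Q P dQ dP QE PE.
exists [set t | exists r s, [/\ Q r, P s, dst r = src s & t = comp_rule r s]].
have matchP r : Q r -> exists2 s, P s & dst r = src s.
  by move=> Qr; have : (dst @` Q) (dst r) by [exists r]; rewrite QE -PE => -[s Ps E]; exists s.
have matchQ s : P s -> exists2 r, Q r & dst r = src s.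
  by move=> Ps; have : (src @` P) (src s) by [exists s]; rewrite PE -QE => -[r Qr E]; exists r.
split.
- rewrite (_ : src @` _ = src @` Q); first exact: rd_src dQ.
  apply/seteqP; split=> [_ [_ [r [s [Qr _ _ ->]]] <-]|_ [r Qr <-]]; first by exists r.
  by have [s Ps rs] := matchP r Qr; exists (comp_rule r s) => //; exists r, s.
- rewrite (_ : dst @` _ = dst @` P); first exact: rd_dst dP.
  apply/seteqP; split=> [_ [_ [r [s [_ Ps _ ->]]] <-]|_ [s Ps <-]]; first by exists s.
  by have [r Qr rs] := matchQ s Ps; exists (comp_rule r s) => //; exists r, s.
- move=> _ _ [r [s [Qr Ps rs ->]]] [r' [s' [Qr' Ps' rs' ->]]] E.
  have Er : r = r' by exact: rd_src_inj dQ _ _ Qr Qr' E.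
  by subst r'; congr comp_rule; apply: (rd_src_inj dP Ps Ps'); rewrite -rs -rs'.
- move=> _ _ [r [s [Qr Ps rs ->]]] [r' [s' [Qr' Ps' rs' ->]]] E.
  have Es : s = s' by exact: rd_dst_inj dP _ _ Ps Ps' E.
  by subst s'; congr comp_rule; apply: (rd_dst_inj dQ Qr Qr'); rewrite rs rs'.
- move=> _ [r [s [Qr Ps rs ->]]].
  have [rok fr Wr] := rd_rule dQ Qr; have [sok gs Ws] := rd_rule dP Ps.
  split; last by apply: W12.
    split=> /=; first by rewrite sok.1 -rs rok.1.
    by case: (turned r) rok.2 => [H _|_ /= ts]; [exact: H|rewrite -rok.1 rs; exact: sok.2].
  by apply: carries_comp => //; [exact: rd_src_edge dQ Qr|exact: rd_dst_edge dQ Qr].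
Qed.

(** * From diagrams to rearrangements *)

Definition all_subedges (D : set word) : set word :=
  [set a | exists e c, [/\ D e, c \in replacement (edge_colour e) & a = rcons e c]].

Lemma all_subedges_code D : prefix_code D -> prefix_code (all_subedges D).
Proof.
move=> [edD anti cover]; split.
- move=> _ [e [c [De cP ->]]].
  by rewrite edge_rconsE ?edD // edge_neq0 ?edD.
- move=> _ t [e [c [De cP ->]]] [e' [c' [De' cP' E]]].
  case/lastP: t E => [//|t c''] /eqP; rewrite -rcons_cat eqseq_rcons cat_rcons.
  by move=> /andP[/eqP E _]; move: De'; rewrite -E => /(anti _ _ De).
- move=> x; have [e De xe] := cover x.
  exists (rcons e (stream x (size e))); last by rewrite size_rcons stream_prefixS xe.
  exists e, (stream x (size e)); split=> //.
  have := stream_edge x (size e).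
  by rewrite stream_prefixS xe edge_rconsE ?edge_neq0 ?edD // => /andP[].
Qed.

Lemma canonical_carries f e e' : carries f (e, e', false) -> canonical f e e'.
Proof. by move=> fr x y w xE yE; apply: fr xE _; rewrite turn_stream0. Qed.

(** Replacing every edge once turns the flipped rules into canonical ones. *)
Lemma rule_diagram_T_A W f Q : homeomorphism f -> rule_diagram W f Q -> T_A f.
Proof.
move=> hf d; split=> //; have eD := rd_src d.
have [l ul lE] := expansion_seq eD.
have cD := all_subedges_code (expansion_code eD).
pose P := [seq rcons e c | e <- l, c <- replacement (edge_colour e)].
have PE : [set` P] = all_subedges (src @` Q).
  rewrite lE; apply/seteqP; split=> a /=.
    by case/allpairsPdep => e [c [el cP ->]]; exists e, c.
  by move=> [e [c [el cP ->]]]; apply/allpairsPdep; exists e, c.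
have inP a : a \in P -> all_subedges (src @` Q) a by rewrite -PE.
exists P; first split.
- by apply/allP => a /inP; exact: prefix_code_edge.
- apply/seteqP; split=> // p _; have [x ->] := pt_surj p.
  have [_ _ cover] := cD; have [a Da xa] := cover x.
  by exists a; [rewrite PE|exists x].
- by move=> a b /inP Da /inP Db; exact: cell_interiors_disjoint cD Da Db.
- move=> _ /inP[_ [c [[r Qr <-] cP ->]]].
  have [[cr br] fr _] := rd_rule d Qr.
  exists (rcons (dst r) (turn (turned r) c)); split.
  + rewrite edge_rconsE ?edge_neq0 ?(rd_dst_edge d Qr) //.
    by rewrite cr turn_replacement.
  + by rewrite !edge_colour_rcons turn_colour.
  + exact/canonical_carries/carries_sub.
Qed.

(** ** The vertex map of a diagram *)

Lemma end_tail_turn k (b i : bool) : (b -> k = Blue) ->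
  turn_stream b (end_tail k i) = end_tail k (i (+) b).
Proof.
move=> bk; apply: funext => n; case: b bk => [/(_ isT) ->|_].
  by case: n; case: i.
by rewrite turn_stream0 addbF.
Qed.

(** A rule maps the endpoints of its source to those of its target, since the
    words running into an endpoint are the same for all edges of a colour. *)
Lemma carries_endpoint f r i p : carries f r -> coloured r ->
  is_edge (src r) -> is_edge (dst r) -> vertex_point (endpoint (src r) i) p ->
  vertex_point (endpoint (dst r) (i (+) turned r)) (f p).
Proof.
move=> fr [cr br] er er' pP.
have [x xE] := Omega_exists (Omega_cat er (end_tail_ok _ i)).
have [y yE] := Omega_exists (Omega_cat er' (end_tail_ok _ (i (+) turned r))).
rewrite (vertex_point_pt pP (endpoint_point er xE)).
rewrite (fr x y _ xE); first exact: endpoint_point.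
by rewrite yE cr end_tail_turn.
Qed.

Lemma endpoint_has_point e i : is_edge e -> exists p, vertex_point (endpoint e i) p.
Proof.
move=> ee; have [x xE] := Omega_exists (Omega_cat ee (end_tail_ok _ i)).
by exists (pt x); exact: endpoint_point.
Qed.

Lemma homeomorphism_inj f : homeomorphism f -> injective f.
Proof. by move=> [_ [g _ [fK _]]]; exact: can_inj fK. Qed.

Section Represent.
Variables (W : rule -> Prop) (f : airplane -> airplane) (Q : set rule).
Hypotheses (hf : homeomorphism f) (d : rule_diagram W f Q).

Definition diagram_of : diagram := {|
  dom := src @` Q;
  cod := dst @` Q;
  emap := fun e => dst (xget ([::], [::], false) [set r | Q r /\ src r = e]);
  vmap := fun v => xget V_l [set v' | exists2 p, vertex_point v p & vertex_point v' (f p)] |}.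

Lemma diagram_of_emap r : Q r -> emap diagram_of (src r) = dst r.
Proof.
move=> Qr /=; congr dst; case: xgetP => [s _ [Qs sE]|/(_ r)[]//].
exact: rd_src_inj d _ _ Qs Qr sE.
Qed.

Lemma diagram_of_vmap r i : Q r ->
  vmap diagram_of (endpoint (src r) i) = endpoint (dst r) (i (+) turned r).
Proof.
move=> Qr /=; have [rok fr _] := rd_rule d Qr.
have move_pt p := carries_endpoint (p := p) (i := i) fr rok (rd_src_edge d Qr) (rd_dst_edge d Qr).
case: xgetP => [v _ [p /move_pt vp]|]; first by move=> /vertex_point_vertex; apply.
have [p vp] := endpoint_has_point i (rd_src_edge d Qr).
by move=> /(_ (endpoint (dst r) (i (+) turned r)))[]; exists p => //; exact: move_pt.
Qed.

Lemma diagram_of_vertices v : vertices (dom diagram_of) v <->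
  exists r i, Q r /\ v = endpoint (src r) i.
Proof.
split=> [[_ [r Qr <-] /incidentP[i ->]]|[r [i [Qr ->]]]]; first by exists r, i.
by exists (src r); [exists r|apply/incidentP; exists i].
Qed.

Lemma diagram_of_vmap_inj v v' : vertices (dom diagram_of) v -> vertices (dom diagram_of) v' ->
  vmap diagram_of v = vmap diagram_of v' -> v = v'.
Proof.
move=> /diagram_of_vertices[r [i [Qr ->]]] /diagram_of_vertices[s [j [Qs ->]]].
rewrite !diagram_of_vmap // => E.
have [rok fr _] := rd_rule d Qr; have [sok fs _] := rd_rule d Qs.
have [p vp] := endpoint_has_point i (rd_src_edge d Qr).
have [q vq] := endpoint_has_point j (rd_src_edge d Qs).
have vfp := carries_endpoint fr rok (rd_src_edge d Qr) (rd_dst_edge d Qr) vp.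
have vfq := carries_endpoint fs sok (rd_src_edge d Qs) (rd_dst_edge d Qs) vq.
rewrite E in vfp; have pq := homeomorphism_inj hf (vertex_point_pt vfp vfq).
by rewrite pq in vp; exact: vertex_point_vertex vp vq.
Qed.

Lemma diagram_of_turned r : Q r ->
  (preserves_direction diagram_of (src r) <-> ~~ turned r) /\
  (reverses_direction diagram_of (src r) <-> turned r).
Proof.
move=> Qr; rewrite /preserves_direction /reverses_direction (diagram_of_emap Qr).
have E i := diagram_of_vmap i Qr; move: (E false) (E true) => /= -> ->.
have neq : endpoint (dst r) false <> endpoint (dst r) true.
  by move/(endpoint_inj (rd_dst_edge d Qr)).
rewrite /initial /terminal -/(endpoint (dst r) false) -/(endpoint (dst r) true).
by case: (turned r); split; split=> //= -[E1 _]; case: neq.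
Qed.

Lemma diagram_of_represents : represents diagram_of f.
Proof.
split; [exact: rd_src d|exact: rd_dst d| |].
- split.
  + split.
    * by move=> _ [r Qr <-]; rewrite diagram_of_emap //; exists r.
    * move=> _ _ /set_mem[r Qr <-] /set_mem[s Qs <-]; rewrite !diagram_of_emap // => E.
      by rewrite (rd_dst_inj d Qr Qs E).
    * by move=> _ [r Qr <-]; exists (src r); [exists r|rewrite diagram_of_emap].
  + split.
    * move=> v /diagram_of_vertices[r [i [Qr ->]]]; rewrite diagram_of_vmap //.
      by exists (dst r); [exists r|apply/incidentP; eexists].
    * by move=> v v' /set_mem vD /set_mem v'D; exact: diagram_of_vmap_inj.
    * move=> v [_ [r Qr <-] /incidentP[i ->]].
      exists (endpoint (src r) (i (+) turned r)).
        by apply/diagram_of_vertices; exists r, (i (+) turned r).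
      by rewrite diagram_of_vmap // -addbA addbb addbF.
  + move=> _ [r Qr <-]; have [[cr br] _ _] := rd_rule d Qr.
    rewrite diagram_of_emap //; split=> //.
    have [[_ pr] [_ re]] := diagram_of_turned Qr.
    by case: (boolP (turned r)) => t; [right; split; [exact: br|exact: re]|left; exact: pr].
- move=> _ [r Qr <-]; have [_ fr _] := rd_rule d Qr.
  have [[pr _] [re _]] := diagram_of_turned Qr.
  rewrite diagram_of_emap //; split=> [/pr t|_ /re t].
    apply: canonical_carries; move: fr; rewrite /carries /= (negbTE t).
    by rewrite /src /dst /turned /=.
  move=> x y c w; rewrite -!cats1 !cat_stream_cat => xE yE; apply: fr xE _.
  rewrite yE; congr cat_stream; apply: funext => -[|n] /=; first by rewrite t.
  by rewrite /cat_stream /= subn1.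
Qed.

End Represent.

(** * Extremal derivatives *)

Fixpoint external_rev (t : word) : bool :=
  match t with
  | [::] => false
  | b_p :: t' => external_rev t'
  | c :: _ => c \in [:: e_L; e_R; s_]
  end.

(** The edges [e t] with [e] radial and [t] a power of [b_p]: those that end at
    an external extreme. *)
Definition external (e : word) : bool := external_rev (rev e).

Lemma external_rcons e c :
  external (rcons e c) = if c is b_p then external e else c \in [:: e_L; e_R; s_].
Proof. by rewrite /external rev_rcons; case: c. Qed.

Lemma external_blue e : external e -> edge_colour e = Blue.
Proof. by case/lastP: e => [//|t c]; rewrite external_rcons edge_colour_rcons; case: c. Qed.

Definition depth (e : word) : nat := find (fun c => c \notin [:: b_m; b_p]) (rev e).

Lemma depth_rcons e c :
  depth (rcons e c) = if c \in [:: b_m; b_p] then (depth e).+1 else 0.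
Proof. by rewrite /depth rev_rcons; case: c. Qed.

Definition external_vertex (v : vertex) : bool :=
  match v with V_l | V_r | V_w _ => true | _ => false end.

Lemma external_vertex_initial e : is_edge e -> ~~ external_vertex (initial e).
Proof.
elim/last_ind: e => [//|e c IH].
have [->|e0] := eqVneq e [::]; first by case: c.
rewrite edge_rconsE // => /andP[/IH vi cP]; rewrite /initial ends_rcons //.
by case: c cP vi => //; case: edge_colour.
Qed.

Lemma external_vertex_terminal e : is_edge e ->
  external_vertex (terminal e) -> external e.
Proof.
elim/last_ind: e => [//|e c IH].
have [->|e0] := eqVneq e [::]; first by case: c.
rewrite edge_rconsE // => /andP[ee cP].
have vi := external_vertex_initial ee; move: IH => /(_ ee).
rewrite external_rcons /terminal ends_rcons //.
case: c cP => //= cP IH; try by move/IH/external_blue => eB; rewrite eB in cP.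
by rewrite -/(initial e) (negbTE vi).
Qed.

Lemma incident_external e v : is_edge e -> incident v e -> external_vertex v -> external e.
Proof.
move=> ee [->|->]; first by rewrite (negbTE (external_vertex_initial ee)).
exact: external_vertex_terminal.
Qed.

Lemma radial_terminal e : radial e -> external_vertex (terminal e).
Proof.
case/andP; case/lastP: e => [//|e c].
have [->|e0] := eqVneq e [::]; first by case: c.
rewrite edge_rconsE // last_rcons /terminal ends_rcons // => /andP[_].
by case: c; case: edge_colour.
Qed.

(** ** Reduction of diagrams *)

Definition preserves_lengths (phi : diagram) : Prop := forall e, dom phi e ->
  external e -> external (emap phi e) /\ depth (emap phi e) = depth e.

Lemma expands_at_preserves_lengths psi e phi f : represents psi f ->
  expands_at psi e phi -> preserves_lengths phi -> preserves_lengths psi.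
Proof.
move=> [eD _ [_ _ iso] _] [De domE _ [oldE _] newE] lphi a Da xa.
have [ae|nae] := pselect (a = e); last first.
  by rewrite -oldE //; apply: lphi => //; rewrite domE; left; split.
subst a; have ee := prefix_code_edge (expansion_code eD) De.
have eB : edge_colour e = Blue.
  case/lastP: (e) xa ee => [//|t c]; rewrite external_rcons edge_colour_rcons.
  by case: c.
have bP : b_p \in replacement (edge_colour e) by rewrite eB.
have [pr re] := newE _ bP.
have [] := lphi (rcons e b_p).
- by rewrite domE; right; exists b_p.
- by rewrite external_rcons.
have [_ [dir|[_ dir]]] := iso _ De.
  by rewrite (pr dir) !external_rcons !depth_rcons /= => -> [->].
by rewrite (re dir) external_rcons.
Qed.

(** A diagram that is not reduced is an expansion of a diagram with fewer edges,
    so repeated reduction stops. *)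
Lemma reduced_diagram_exists phi f : represents phi f -> preserves_lengths phi ->
  exists2 phi0, reduced_diagram phi0 f & preserves_lengths phi0.
Proof.
move=> rphi; have [eD _ _ _] := rphi; have [l ul lE] := expansion_seq eD.
have [n] := ubnP (size l); elim: n phi l rphi eD ul lE => [//|n IH] phi l rphi eD ul lE ln lphi.
have [red|] := pselect (reduced_diagram phi f); first by exists phi.
move=> nred; have [psi [e [rpsi xpsi]]] : exists psi e, represents psi f /\ expands_at psi e phi.
  apply: contrapT => H; apply: nred; split=> // psi e rpsi xpsi; apply: H.
  by exists psi, e.
have [eD' _ _ _] := rpsi; have [l' ul' lE'] := expansion_seq eD'.
have lpsi := expands_at_preserves_lengths rpsi xpsi lphi.
apply: (IH psi l') => //; rewrite ltnS in ln; apply: leq_trans ln.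
have [De domE _ _ _] := xpsi.
have [c [c' [cP cP' ncc']]] : exists c c', [/\ c \in replacement (edge_colour e),
    c' \in replacement (edge_colour e) & c != c'].
  by case: edge_colour; [exists r_1, r_2|exists b_m, b_p].
have el' : e \in l' by move: De; rewrite lE'.
have new a : rcons e a \notin l'.
  apply/negP => al'; apply: (prefix_code_rcons (expansion_code eD') De (c := a)).
  by rewrite lE'.
have -> : (size l').+1 = size (rcons e c :: rcons e c' :: rem e l').
  by rewrite /= size_rem // prednK //; case: (l') el'.
apply: uniq_leq_size.
  rewrite /= inE !negb_or rem_uniq // !andbT.
  rewrite eqseq_rcons eqxx /= ncc' /=.
  by rewrite !(contra (@mem_rem _ _ _ _)).
move=> a; rewrite !inE mem_rem_uniq // inE => H.
suff: dom phi a by rewrite lE.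
rewrite domE; case/or3P: H => [/eqP ->|/eqP ->|/andP[/eqP nae al']].
- by right; exists c.
- by right; exists c'.
- by left; split=> //; rewrite lE'.
Qed.

(** ** Rules that preserve lengths at the external extremes *)

Definition preserves_length (r : rule) : Prop :=
  external (dst r) = external (src r) /\
  (external (src r) -> ~~ turned r /\ depth (dst r) = depth (src r)).

Lemma rule_diagram_E f Q : homeomorphism f -> rule_diagram preserves_length f Q ->
  E_subgroup f.
Proof.
move=> hf d; split; first exact: rule_diagram_T_A d.
move=> p [e0 re0 e0p].
have [phi [rphi red] lphi] : exists2 phi, reduced_diagram phi f & preserves_lengths phi.
  apply: reduced_diagram_exists; first exact: diagram_of_represents hf d.
  move=> _ [r Qr <-] xr; rewrite (diagram_of_emap d Qr).
  by have [_ _ [-> H]] := rd_rule d Qr; have [] := H xr.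
exists phi => //; have [[v [[e De ve] vp]]|nv] :=
  pselect (exists v, vertices (dom phi) v /\ vertex_point v p); last first.
  by left; split=> // v vD vp; apply: nv; exists v.
right; exists v, e; split=> //.
have [eD _ _ _] := rphi; have ee := prefix_code_edge (expansion_code eD) De.
have xe : external e.
  apply: incident_external ee ve _.
  by rewrite (vertex_point_vertex vp e0p) radial_terminal.
have [_ dE] := lphi e De xe.
by rewrite /edge_length -/(depth e) -/(depth (emap phi e)) dE GRing.divff.
Qed.

(** Edges of the ray of [e_R] that end at [V_r]. *)
Definition right_end (e : word) : bool :=
  if e is e_R :: t then all (fun c => c == b_p) t else false.

Lemma right_end_rcons e c : e != [::] -> right_end (rcons e c) = (c == b_p) && right_end e.
Proof. by case: e => [//|a t] _; case: a => //=; rewrite ?andbF // all_rcons. Qed.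

Lemma right_end_external e : right_end e -> external e.
Proof.
elim/last_ind: e => [//|e c IH]; have [->|e0] := eqVneq e [::]; first by case: c.
by rewrite right_end_rcons // external_rcons => /andP[/eqP -> /IH].
Qed.

(** Rules that preserve lengths at all external extremes except possibly [V_r],
    which they fix and where they multiply lengths by the [-s]-th power of 2. *)
Definition shifts_right_end (s : int) (r : rule) : Prop :=
  [/\ external (dst r) = external (src r),
      right_end (dst r) = right_end (src r)
    & external (src r) -> ~~ turned r /\
        Posz (depth (dst r)) = (Posz (depth (src r)) + if right_end (src r) then s else 0)%R].

Lemma shifts_right_end0 r : shifts_right_end 0%R r -> preserves_length r.
Proof.
move=> [E1 E2 H]; split=> // /H[nt E]; split=> //.
by move: E; rewrite if_same GRing.addr0 => -[].
Qed.

Lemma preserves_length_inv r : preserves_length r -> preserves_length (inv_rule r).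
Proof. by move=> [E H]; split=> //=; rewrite E => /H[nt ->]. Qed.

Lemma preserves_length_comp r s : dst r = src s -> preserves_length r ->
  preserves_length s -> preserves_length (comp_rule r s).
Proof.
move=> rs [E H] [E' H']; rewrite -rs E in E' H'; split=> //= xr.
have [nt dE] := H xr; have [nt' dE'] := H' xr.
split; first by rewrite (negbTE nt) (negbTE nt').
by rewrite -dE -dE'.
Qed.

Lemma shifts_right_end_inv s r : shifts_right_end s r -> shifts_right_end (- s)%R (inv_rule r).
Proof.
move=> [E R H]; split=> //=; rewrite E => xr; have [nt dE] := H xr; split=> //.
rewrite -[dst (inv_rule r)]/(src r) -[src (inv_rule r)]/(dst r) R.
by case: (right_end _) dE; lia.
Qed.

Lemma shifts_right_end_comp s s' r r' : dst r = src r' -> shifts_right_end s r ->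
  shifts_right_end s' r' -> shifts_right_end (s + s')%R (comp_rule r r').
Proof.
move=> rs [E R H] [E' R' H']; rewrite -rs in E' R' H'; rewrite E R in E' R' H'.
split=> //= xr; have [nt dE] := H xr; have [nt' dE'] := H' xr.
split; first by rewrite (negbTE nt) (negbTE nt').
rewrite -[dst (comp_rule r r')]/(dst r') -[src (comp_rule r r')]/(src r).
by case: (right_end _) dE dE'; lia.
Qed.

Lemma preserves_length_stable : stable preserves_length.
Proof.
move=> r c er er' [cr br] [E H] cP; rewrite /preserves_length src_sub dst_sub.
rewrite !external_rcons !depth_rcons.
have [tr|nt] := boolP (turned r); last first.
  by rewrite /turn; case: c cP => //= _; rewrite E; split=> // /H[_ ->].
have nx : external (src r) = false.
  by apply: contraTF tr => /H[].
by move: cP; rewrite br //; case: c => //= _; rewrite ?E ?nx.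
Qed.

Lemma shifts_right_end_stable s : stable (shifts_right_end s).
Proof.
move=> r c er er' [cr br] [E R H] cP; rewrite /shifts_right_end src_sub dst_sub.
rewrite !external_rcons !depth_rcons.
rewrite !right_end_rcons ?edge_neq0 //.
have [tr|nt] := boolP (turned r); last first.
  rewrite /turn; case: c cP => //= _; rewrite ?E ?R; split=> // /H[_].
  by case: (right_end _) => dE; split=> //; lia.
have nx : external (src r) = false.
  by apply: contraTF tr => /H[].
have nr : right_end (src r) = false by apply: contraFF nx; exact: right_end_external.
by move: cP; rewrite br //; case: c => //= _; rewrite ?E ?R ?nx ?nr ?andbF.
Qed.

(** * Rearrangements from finite lists of rules *)

Definition rule_word (r : rule) (w : word) : word :=
  dst r ++ turn_word (turned r) (drop (size (src r)) w).

(** The action of a rule on the vertices of the cell of its source; an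
    interior vertex carries the name of the edge whose replacement created it,
    and turning exchanges the two new vertices of a blue edge. *)
Definition rule_vertex (r : rule) (v : vertex) : vertex :=
  if v == endpoint (src r) false then endpoint (dst r) (turned r)
  else if v == endpoint (src r) true then endpoint (dst r) (~~ turned r)
  else match v with
  | V_m w => V_m (rule_word r w)
  | V_w w => V_w (rule_word r w)
  | V_x w => if turned r && (w == src r) then V_y (dst r) else V_x (rule_word r w)
  | V_y w => if turned r && (w == src r) then V_x (dst r) else V_y (rule_word r w)
  | _ => v
  end.

Lemma rule_vertex_endpoint r i : is_edge (src r) ->
  rule_vertex r (endpoint (src r) i) = endpoint (dst r) (i (+) turned r).
Proof.
move=> er; rewrite /rule_vertex; case: i; rewrite ?eqxx //.
by case: eqP => [/(endpoint_inj er)|_].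
Qed.

Lemma rule_word_cat r t : rule_word r (src r ++ t) = dst r ++ turn_word (turned r) t.
Proof. by rewrite /rule_word drop_size_cat. Qed.

Lemma turn_word_rcons b t c : t != [::] -> turn_word b (rcons t c) = rcons (turn_word b t) c.
Proof. by case: t. Qed.

Lemma old_vertex e v w i : e != [::] -> size e <= size w -> vertex_name v = w ->
  (v == endpoint e i) = false.
Proof.
move=> e0 ew vw; apply/eqP => E; have := endpoint_level i e0.
by rewrite -E vw ltnNge ew.
Qed.

Lemma rule_vertex_m r t : src r != [::] ->
  rule_vertex r (V_m (src r ++ t)) = V_m (dst r ++ turn_word (turned r) t).
Proof.
move=> r0; rewrite /rule_vertex !(old_vertex (w := src r ++ t)) // ?rule_word_cat //.
all: by rewrite size_cat leq_addr.
Qed.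

Lemma rule_vertex_w r t : src r != [::] ->
  rule_vertex r (V_w (src r ++ t)) = V_w (dst r ++ turn_word (turned r) t).
Proof.
move=> r0; rewrite /rule_vertex !(old_vertex (w := src r ++ t)) // ?rule_word_cat //.
all: by rewrite size_cat leq_addr.
Qed.

Lemma cat_eq_left (e t : word) : (e ++ t == e) = (t == [::]).
Proof. by rewrite -{2}[e]cats0 eqseq_cat ?eqxx. Qed.

Lemma rule_vertex_x r t : src r != [::] -> rule_vertex r (V_x (src r ++ t)) =
  if turned r && (t == [::]) then V_y (dst r) else V_x (dst r ++ turn_word (turned r) t).
Proof.
move=> r0; rewrite /rule_vertex !(old_vertex (w := src r ++ t)) // ?rule_word_cat ?cat_eq_left //.
all: by rewrite size_cat leq_addr.
Qed.

Lemma rule_vertex_y r t : src r != [::] -> rule_vertex r (V_y (src r ++ t)) =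
  if turned r && (t == [::]) then V_x (dst r) else V_y (dst r ++ turn_word (turned r) t).
Proof.
move=> r0; rewrite /rule_vertex !(old_vertex (w := src r ++ t)) // ?rule_word_cat ?cat_eq_left //.
all: by rewrite size_cat leq_addr.
Qed.

(** An endpoint of a replacement edge is either an endpoint of the replaced edge
    or a vertex named after it; both are translated along with the edge. *)
Lemma rule_vertex_cat r t i : t != [::] -> coloured r -> is_edge (src r) ->
  is_edge (dst r) -> is_edge (src r ++ t) ->
  endpoint (dst r ++ turn_word (turned r) t) i = rule_vertex r (endpoint (src r ++ t) i).
Proof.
move=> t0 [cr br] er er'; have r0 := edge_neq0 er; have r0' := edge_neq0 er'.
elim/last_ind: t t0 i => [//|t c IH] _ i.
have vE j := rule_vertex_endpoint j er.
have [->|t0] := eqVneq t [::].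
  rewrite !cats1 edge_rconsE // => /andP[_ cP].
  have vm := rule_vertex_m [::] r0; have vw := rule_vertex_w [::] r0.
  have vx := rule_vertex_x [::] r0; have vy := rule_vertex_y [::] r0.
  rewrite cats0 /= ?cats0 ?andbT in vm vw vx vy.
  rewrite !endpoint_rcons //.
  have [vf vt] := (vE false, vE true); rewrite /endpoint /= in vf vt.
  case: (turned r) br vm vw vx vy vf vt => /= br vm vw vx vy vf vt.
    move: cP; rewrite br //; case: c => //= _; case: i;
    by rewrite ?vm ?vw ?vx ?vy -?/(initial _) -?/(terminal _) ?vf ?vt.
  case: c cP => //= _; case: i;
  by rewrite ?vm ?vw ?vx ?vy -?/(initial _) -?/(terminal _) ?vf ?vt.
have t0r : src r ++ t != [::] by case: (src r) r0.
have t0r' : dst r ++ turn_word (turned r) t != [::] by case: (dst r) r0'.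
rewrite turn_word_rcons // -!rcons_cat edge_rconsE // => /andP[/IH{}IH cP].
rewrite !endpoint_rcons //.
have [If It] := (IH t0 false, IH t0 true); rewrite /endpoint /= in If It.
case: c cP => //= _; case: i;
  by rewrite ?rule_vertex_m ?rule_vertex_w ?rule_vertex_x ?rule_vertex_y
     -?/(initial _) -?/(terminal _) ?If ?It // (negbTE t0) andbF.
Qed.

Lemma rule_vertex_eventually r v w : coloured r -> is_edge (src r) -> is_edge (dst r) ->
  tail_ok (edge_colour (src r)) w ->
  eventually_incident v (cat_stream (src r) w) ->
  eventually_incident (rule_vertex r v) (cat_stream (dst r) (turn_stream (turned r) w)).
Proof.
move=> rok er er' wok [N vN]; exists (size (dst r) + N.+1)%N => n nN.
have -> : n = (size (dst r) + (n - size (dst r)).-1.+1)%N by lia.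
set m := (n - size (dst r)).-1.
rewrite stream_prefix_catD turn_stream_prefix.
have /incidentP[i vi] : incident v (src r ++ stream_prefix w m.+1).
  by rewrite -stream_prefix_catD; apply: vN; rewrite /m; lia.
apply/incidentP; exists i; rewrite vi rule_vertex_cat //.
exact: tail_prefix.
Qed.

(** Words of two different cells already differ at the level of the shorter edge,
    so the vertex that they share is as old as both edges. *)
Lemma code_vertex D (x y : Omega) e e' v : prefix_code D -> D e -> D e' -> e <> e' ->
  stream_prefix (stream x) (size e) = e -> stream_prefix (stream y) (size e') = e' ->
  eventually_incident v (stream x) -> eventually_incident v (stream y) ->
  incident v e /\ incident v e'.
Proof.
move=> cD; wlog le : x y e e' / size e <= size e'.
  move=> W De De' ne xe ye' vx vy; have [le|/ltnW le] := leqP (size e) (size e').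
    exact: (W x y).
  by apply/and_comm; apply: (W y x) => //; exact/nesym.
move=> De De' ne xe ye' [N vN] [N' vN'].
have e0 := edge_neq0 (prefix_code_edge cD De).
have e0' := edge_neq0 (prefix_code_edge cD De').
have neq : stream_prefix (stream x) (size e).-1.+1 <> stream_prefix (stream y) (size e).-1.+1.
  rewrite prednK ?lt0n ?size_eq0 // xe => E; apply: ne.
  have E' : e' = e ++ drop (size e) e'.
    by rewrite -{1}(cat_take_drop (size e) e') -{1}ye' take_stream_prefix // -E.
  have [_ anti _] := cD.
  have t0 : drop (size e) e' = [::] by apply: (anti e) => //; rewrite -E'.
  by rewrite E' t0 cats0.
pose m := (N + N' + size e')%N.
have sE : ((size e).-1.+1 + (m - size e) = m)%N.
  by rewrite prednK ?lt0n ?size_eq0 // subnKC // /m; lia.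
have vxm : incident v (stream_prefix (stream x) ((size e).-1.+1 + (m - size e))).
  by apply: vN; rewrite sE /m -addnA leq_addr.
have vym : incident v (stream_prefix (stream y) ((size e).-1.+1 + (m - size e))).
  by apply: vN'; rewrite sE /m; lia.
have [ve _] := incident_descend neq vxm vym.
rewrite prednK ?lt0n ?size_eq0 // xe in ve; split=> //.
have lv : size (vertex_name v) < size e' := leq_trans (incident_level e0 ve) le.
apply: (incident_ancestor e0' lv (t := stream_prefix (fun k => stream y (size e' + k)) (N + N'))).
by rewrite -{1}ye' -stream_prefixD; apply: vN'; lia.
Qed.

(** A bijection between two prefix codes that respects colours and incidences,
    that is, an isomorphism between the two graphs. *)
Record substitution (Q : set rule) : Prop := Substitution {
  sb_src : prefix_code (src @` Q);
  sb_dst : prefix_code (dst @` Q);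
  sb_src_inj : forall r s, Q r -> Q s -> src r = src s -> r = s;
  sb_dst_inj : forall r s, Q r -> Q s -> dst r = dst s -> r = s;
  sb_coloured : forall r, Q r -> coloured r;
  sb_glue : forall r s i j, Q r -> Q s ->
    endpoint (src r) i = endpoint (src s) j <->
    endpoint (dst r) (i (+) turned r) = endpoint (dst s) (j (+) turned s) }.

Lemma substitution_inv Q : substitution Q -> substitution (inv_rule @` Q).
Proof.
move=> sQ.
have E1 : src @` (inv_rule @` Q) = dst @` Q by rewrite image_comp.
have E2 : dst @` (inv_rule @` Q) = src @` Q by rewrite image_comp.
split.
- by rewrite E1; exact: sb_dst.
- by rewrite E2; exact: sb_src.
- by move=> _ _ [r Qr <-] [s Qs <-] E; congr inv_rule; exact: sb_dst_inj sQ _ _ Qr Qs E.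
- by move=> _ _ [r Qr <-] [s Qs <-] E; congr inv_rule; exact: sb_src_inj sQ _ _ Qr Qs E.
- by move=> _ [r Qr <-]; apply/inv_coloured/(sb_coloured sQ Qr).
- move=> _ _ i j [r Qr <-] [s Qs <-].
  rewrite -[src (inv_rule r)]/(dst r) -[dst (inv_rule r)]/(src r).
  rewrite -[src (inv_rule s)]/(dst s) -[dst (inv_rule s)]/(src s).
  rewrite -[turned (inv_rule r)]/(turned r) -[turned (inv_rule s)]/(turned s).
  have := sb_glue sQ (i (+) turned r) (j (+) turned s) Qr Qs.
  by rewrite -!addbA !addbb !addbF => H; apply: iff_sym.
Qed.

Section Realize.
Variables (Q : set rule) (sQ : substitution Q).

Lemma sb_src_edge r : Q r -> is_edge (src r).
Proof. by move=> Qr; apply: (prefix_code_edge (sb_src sQ)); exists r. Qed.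

Lemma sb_dst_edge r : Q r -> is_edge (dst r).
Proof. by move=> Qr; apply: (prefix_code_edge (sb_dst sQ)); exists r. Qed.

Definition applies (r : rule) (x y : Omega) : Prop := exists w,
  [/\ Q r, stream x = cat_stream (src r) w &
      stream y = cat_stream (dst r) (turn_stream (turned r) w)].

Lemma applies_exists (x : Omega) : exists y, exists r, applies r x y.
Proof.
have [_ _ /(_ x)[_ [r Qr <-] xr]] := sb_src sQ.
have xE := cat_streamE xr; set w := fun n => _ in xE.
have rok := sb_coloured sQ Qr; have [cr br] := rok.
have wok : tail_ok (edge_colour (src r)) w.
  by apply: Omega_tail; rewrite ?edge_neq0 ?sb_src_edge // -xE; exact: set_valP x.
have [y yE] : exists y : Omega, stream y = cat_stream (dst r) (turn_stream (turned r) w).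
  apply/Omega_exists/Omega_cat; first exact: sb_dst_edge.
  by rewrite cr; exact: turn_stream_ok.
by exists y, r, w.
Qed.

Definition word_map (x : Omega) : Omega := projT1 (cid (applies_exists x)).

Lemma word_mapP x : exists r, applies r x (word_map x).
Proof. exact: projT2 (cid (applies_exists x)). Qed.

Lemma word_map_rule r w x y : Q r -> stream x = cat_stream (src r) w ->
  stream y = cat_stream (dst r) (turn_stream (turned r) w) -> word_map x = y.
Proof.
move=> Qr xE yE; have [s [w' [Qs xE' gE]]] := word_mapP x.
have rs : r = s.
  apply: (sb_src_inj sQ Qr Qs).
  apply: (prefix_code_uniq (x := x) (sb_src sQ)); [by exists r|by exists s| |].
    by rewrite xE stream_prefix_cat_stream.
  by rewrite xE' stream_prefix_cat_stream.
subst s; apply: stream_inj; rewrite gE yE; congr (cat_stream _ (turn_stream _ _)).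
by apply: (@cat_stream_inj (src r)); rewrite -xE -xE'.
Qed.

Lemma word_map_pt x y : pt x = pt y -> pt (word_map x) = pt (word_map y).
Proof.
move=> xy; have [->//|nxy] := pselect (x = y).
have [v [vx vy]] := pt_eq_vertex xy nxy.
have [r [w [Qr xE gxE]]] := word_mapP x; have [s [w' [Qs yE gyE]]] := word_mapP y.
have tail u q w0 : Q q -> stream u = cat_stream (src q) w0 -> tail_ok (edge_colour (src q)) w0.
  move=> Qq uE; apply: Omega_tail; first by rewrite edge_neq0 ?sb_src_edge.
  by rewrite -uE; exact: set_valP u.
have same : rule_vertex r v = rule_vertex s v.
  have [->//|nrs] := pselect (r = s).
  have [/incidentP[i vi] /incidentP[j vj]] : incident v (src r) /\ incident v (src s).
    apply: (code_vertex (sb_src sQ) _ _ _ _ _ vx vy).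
    - by exists r.
    - by exists s.
    - by move=> E; apply: nrs; exact: sb_src_inj sQ _ _ Qr Qs E.
    - by rewrite xE stream_prefix_cat_stream.
    - by rewrite yE stream_prefix_cat_stream.
  rewrite {1}vi {1}vj !rule_vertex_endpoint ?sb_src_edge //.
  by apply/(sb_glue sQ i j Qr Qs); rewrite -vi -vj.
rewrite xE in vx; rewrite yE in vy.
apply: (eventually_incident_pt (v := rule_vertex r v)).
  rewrite gxE; apply: rule_vertex_eventually => //.
  - exact: sb_coloured Qr.
  - exact: sb_src_edge.
  - exact: sb_dst_edge.
  - exact: tail Qr xE.
rewrite gyE same; apply: rule_vertex_eventually => //.
- exact: sb_coloured Qs.
- exact: sb_src_edge.
- exact: sb_dst_edge.
- exact: tail Qs yE.
Qed.

Lemma word_map_local x n : exists N, forall y, agree N x y -> agree n (word_map x) (word_map y).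
Proof.
have [r [w [Qr xE gE]]] := word_mapP x.
exists (size (src r) + n)%N => y; rewrite /agree xE stream_prefix_catD => E.
have ye : stream_prefix (stream y) (size (src r)) = src r.
  by rewrite -(@take_stream_prefix _ _ (size (src r) + n)) ?leq_addr // -E take_size_cat.
have yE := cat_streamE ye; set w' := fun k => _ in yE.
have wE : stream_prefix w n = stream_prefix w' n.
  by move/eqP: E; rewrite yE stream_prefix_catD eqseq_cat // eqxx => /eqP.
have w'ok : tail_ok (edge_colour (src r)) w'.
  apply: Omega_tail; first by rewrite edge_neq0 ?sb_src_edge.
  by rewrite -yE; exact: set_valP y.
have [cr br] := sb_coloured sQ Qr.
have [z zE] : exists z : Omega, stream z = cat_stream (dst r) (turn_stream (turned r) w').
  apply/Omega_exists/Omega_cat; first exact: sb_dst_edge.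
  by rewrite cr; exact: turn_stream_ok.
rewrite (word_map_rule Qr yE zE) gE zE.
rewrite -(@take_stream_prefix _ n (size (dst r) + n)) ?leq_addl //.
rewrite -(@take_stream_prefix (cat_stream _ (turn_stream _ w')) n (size (dst r) + n)) ?leq_addl //.
by rewrite !stream_prefix_catD !turn_stream_prefix wE.
Qed.

Definition induced_map (p : airplane) : airplane := pt (word_map (repr p)).

Lemma induced_map_pt x : induced_map (pt x) = pt (word_map x).
Proof. by apply: word_map_pt; rewrite /pt reprK. Qed.

Lemma induced_map_continuous : continuous induced_map.
Proof. exact: continuous_induced induced_map_pt word_map_local. Qed.

Lemma induced_map_carries r : Q r -> carries induced_map r.
Proof. by move=> Qr x y w xE yE; rewrite induced_map_pt (word_map_rule Qr xE yE). Qed.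

End Realize.

Lemma induced_mapK Q (sQ : substitution Q) Q' (sQ' : substitution Q') :
  (forall r, Q r -> Q' (inv_rule r)) -> cancel (induced_map sQ) (induced_map sQ').
Proof.
move=> QQ' p; have [x ->] := pt_surj p; rewrite !induced_map_pt.
have [r [w [Qr xE gE]]] := word_mapP sQ x; congr pt.
apply: (word_map_rule sQ' (QQ' _ Qr) gE).
by rewrite turn_streamD addbb turn_stream0.
Qed.

(** A graph isomorphism defines a homeomorphism of the limit space: well defined
    because incidences are respected, and invertible because the inverse
    isomorphism defines its inverse. *)
Lemma substitution_realize Q : substitution Q ->
  exists2 f, homeomorphism f & forall r, Q r -> carries f r.
Proof.
move=> sQ; have sQ' := substitution_inv sQ.
exists (induced_map sQ); last exact: induced_map_carries.
split; first exact: induced_map_continuous.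
exists (induced_map sQ'); first exact: induced_map_continuous.
split; apply: induced_mapK; first by move=> r Qr; exists r.
by move=> _ [r Qr <-]; case: r Qr => [[]].
Qed.

(** * Components and their boundaries *)

Definition blue_edge (e : word) : bool := is_edge e && is_blue e.

Lemma blue_edgeE e : blue_edge e = is_edge e && `[< edge_colour e = Blue >].
Proof. by congr (_ && _); apply/idP/asboolP => /is_blueP. Qed.

(** The empty word, which is no edge, stands for the central component. *)
Definition comp (e : word) : component := insub e.

Lemma comp_blue e (eb : is_edge e && `[< edge_colour e = Blue >]) : comp e = Some (Sub e eb).
Proof. exact: insubT. Qed.

Lemma comp_cases C : C = comp [::] \/ exists2 e, blue_edge e & C = comp e.
Proof.
case: C => [e|]; last by left; rewrite /comp insubF.
right; exists (val e); first by rewrite blue_edgeE; exact: valP e.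
by rewrite /comp valK.
Qed.

Lemma comp_inj e e' : blue_edge e -> blue_edge e' -> comp e = comp e' -> e = e'.
Proof.
rewrite !blue_edgeE => eb eb'; rewrite (comp_blue eb) (comp_blue eb').
by move=> [].
Qed.

(** The part of a component contained in the cell of one of its red edges. *)
Definition arc (c : word) : set airplane :=
  [set p | exists (x : Omega) w, [/\ p = pt x, stream x = cat_stream c w &
     forall n, w n = r_1 \/ w n = r_2]].

Lemma boundary_arcs C :
  boundary C = arc (component_edges C).1 `|` arc (component_edges C).2.
Proof.
apply/seteqP; split=> p.
  by move=> [x [c [w [-> [->|->] xE wr]]]]; [left|right]; exists x, w.
move=> [] [x [w [-> xE wr]]]; exists x.
  by exists (component_edges C).1, w; split=> //; left.
by exists (component_edges C).2, w; split=> //; right.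
Qed.

Lemma boundary_comp e : blue_edge e ->
  boundary (comp e) = arc (rcons e u_) `|` arc (rcons e d_).
Proof. by rewrite blue_edgeE => eb; rewrite boundary_arcs (comp_blue eb). Qed.

Lemma boundary_central : boundary (comp [::]) = arc [:: e_U] `|` arc [:: e_D].
Proof. by rewrite boundary_arcs /comp insubF. Qed.

Lemma arc_split c : arc c = arc (rcons c r_1) `|` arc (rcons c r_2).
Proof.
apply/seteqP; split=> p.
  move=> [x [w [-> xE wr]]].
  have xE' : stream x = cat_stream (rcons c (w 0)) (fun n => w n.+1).
    rewrite xE -cats1 cat_stream_cat; congr cat_stream.
    by apply: funext => -[|n] //; rewrite (cat_streamD [:: w 0]).
  by case: (wr 0) xE' => -> xE'; [left|right]; exists x, (fun n => w n.+1).
move=> [] [x [w [-> xE wr]]]; rewrite -cats1 cat_stream_cat in xE.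
  by exists x, (cat_stream [:: r_1] w); split=> // -[|n]; [left|rewrite (cat_streamD [:: r_1])].
by exists x, (cat_stream [:: r_2] w); split=> // -[|n]; [right|rewrite (cat_streamD [:: r_2])].
Qed.

Lemma last_red_letter c w c' w' : c != [::] ->
  last e_U c != r_1 -> last e_U c != r_2 -> (forall n, w' n = r_1 \/ w' n = r_2) ->
  cat_stream c w = cat_stream c' w' -> size c <= size c'.
Proof.
case/lastP: c => [//|c a] _; rewrite last_rcons => a1 a2 wr E.
rewrite leqNgt; apply/negP; rewrite size_rcons ltnS => le.
have: cat_stream (rcons c a) w (size c) = a.
  by rewrite /cat_stream nth_rcons ltnn eqxx.
rewrite E -(subnKC le) cat_streamD => wa.
by move: a1 a2; rewrite -wa; case: (wr (size c - size c')%N) => ->; rewrite eqxx.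
Qed.

Lemma component_edges_last C c : c = (component_edges C).1 \/ c = (component_edges C).2 ->
  [/\ is_edge c, edge_colour c = Red, last e_U c != r_1 & last e_U c != r_2].
Proof.
case: C => [e|] /=; last by case=> ->.
have ee : is_edge (val e) by case/andP: (valP e).
have /andP[_ /asboolP eB] := valP e.
by case=> ->; rewrite edge_rconsE ?edge_neq0 // ee eB edge_colour_rcons last_rcons.
Qed.

(** A component is determined by its boundary: a word of its boundary that is
    alone in its class shows the red edges of the component as the longest
    prefix not ending in [r_1] or [r_2]. *)
Lemma boundary_inj : injective boundary.
Proof.
move=> C C' E.
have [ce cr c1 c2] := component_edges_last (or_introl (erefl (component_edges C).1)).
set c := (component_edges C).1 in ce cr c1 c2.
have [x xE] := Omega_exists (Omega_cat ce (zigzag_ok _)).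
have zr n : zigzag (edge_colour c) n = r_1 \/ zigzag (edge_colour c) n = r_2.
  by rewrite cr /=; case: (odd n); [right|left].
have : boundary C (pt x) by exists x, c, (zigzag (edge_colour c)); split=> //; left.
rewrite E => -[y [c' [w [xy c'P yE wr]]]].
have [c'e c'r c'1 c'2] := component_edges_last c'P.
have xy' := zigzag_class ce xE xy; rewrite -xy' xE in yE.
have sc : size c = size c'.
  apply/eqP; rewrite eqn_leq; apply/andP; split.
    exact: last_red_letter (edge_neq0 ce) c1 c2 wr yE.
  exact: last_red_letter (edge_neq0 c'e) c'1 c'2 zr (esym yE).
have cc' : c = c'.
  rewrite -(stream_prefix_cat_stream c (zigzag (edge_colour c))) yE sc.
  exact: stream_prefix_cat_stream.
move: c'P; rewrite -cc' /c; case: (C) (C') => [e|] [e'|] //=.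
- move=> [] /eqP; rewrite eqseq_rcons => /andP[/eqP ee' //] _.
  by congr Some; apply: val_inj.
- by case=> /(congr1 size); rewrite size_rcons => -[/size0nil];
    case/andP: (valP e) => /edge_neq0/eqP.
- by case=> /(congr1 size); rewrite size_rcons => -[/esym/size0nil];
    case/andP: (valP e') => /edge_neq0/eqP.
Qed.

Lemma maps_component_comp f g P Q R : maps_component f P Q -> maps_component g Q R ->
  maps_component (g \o f) P R.
Proof. by rewrite /maps_component -image_comp => -> ->. Qed.

Lemma maps_component_inv f g P Q : inverse_maps f g -> maps_component f P Q ->
  maps_component g Q P.
Proof.
move=> [fK _]; rewrite /maps_component => <-; rewrite image_comp.
by apply/seteqP; split=> [_ [p Pp <-]|p Pp]; [rewrite /= fK|exists p; rewrite //= fK].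
Qed.

(** ** Action of a rule on components *)

Lemma carries_cat f r t : t != [::] -> carries f r ->
  carries f (src r ++ t, dst r ++ turn_word (turned r) t, false).
Proof.
case: t => [//|c t] _ fr x y w; rewrite turn_stream0 !cat_stream_cat => xE yE.
apply: fr xE _; rewrite yE; congr cat_stream; apply: funext => -[|n] //=.
Qed.

Lemma carries_arc f e e' : is_edge e -> is_edge e' -> edge_colour e = edge_colour e' ->
  carries f (e, e', false) -> f @` arc e = arc e'.
Proof.
move=> ee ee' cE fe.
have move_tail a b (x : Omega) w : is_edge a -> is_edge b -> edge_colour a = edge_colour b ->
    stream x = cat_stream a w -> exists y : Omega, stream y = cat_stream b w.
  move=> ea eb cab xE; apply/Omega_exists/Omega_cat; rewrite // -cab.
  by apply: Omega_tail; rewrite ?edge_neq0 // -xE; exact: set_valP x.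
have fpt x y w : stream x = cat_stream e w -> stream y = cat_stream e' w -> f (pt x) = pt y.
  by move=> xE yE; apply: fe xE _; rewrite turn_stream0.
apply/seteqP; split=> [_ [_ [x [w [-> xE wr]]] <-]|_ [y [w [-> yE wr]]]].
  by have [y yE] := move_tail _ _ _ _ ee ee' cE xE; exists y, w; rewrite (fpt x y w).
have [x xE] := move_tail _ _ _ _ ee' ee (esym cE) yE.
by exists (pt x); [exists x, w|rewrite (fpt x y w)].
Qed.

Lemma rule_edge r t : coloured r -> is_edge (src r) -> is_edge (dst r) ->
  is_edge (src r ++ t) -> is_edge (dst r ++ turn_word (turned r) t).
Proof.
move=> [cr br] er er'; elim/last_ind: t => [|t c IH]; first by rewrite !cats0.
rewrite -rcons_cat edge_rconsE; last by case: (src r) er.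
move=> /andP[/IH et]; have [->|t0] := eqVneq t [::].
  by rewrite cats0 cats1 edge_rconsE ?edge_neq0 // er' cr /= turn_replacement.
rewrite turn_word_rcons // -rcons_cat edge_rconsE ?et; last by case: (dst r) er'.
rewrite !edge_colour_cat //; last by case: (t) t0.
case: t t0 {IH et} => [//|a t] _; rewrite /edge_colour /=.
by case: t => [|b t] //=; rewrite turn_colour.
Qed.

Lemma rule_blue r t : coloured r -> is_blue (dst r ++ turn_word (turned r) t) = is_blue (src r ++ t).
Proof.
move=> [cr _]; rewrite /is_blue; have [->|t0] := eqVneq t [::]; first by rewrite !cats0 cr.
rewrite !edge_colour_cat //; last by case: (t) t0.
case: t t0 => [//|a t] _; rewrite /edge_colour /=.
by case: t => [|b t] //=; rewrite turn_colour.
Qed.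

Lemma rule_maps_component f r t : carries f r -> coloured r -> is_edge (src r) ->
  is_edge (dst r) -> blue_edge (src r ++ t) ->
  maps_component f (comp (src r ++ t)) (comp (dst r ++ turn_word (turned r) t)).
Proof.
move=> fr rok er er' /andP[et eb].
have et' := rule_edge rok er er' et.
have eb' : is_blue (dst r ++ turn_word (turned r) t) by rewrite rule_blue.
have arcE c : c \in [:: u_; d_] -> f @` arc (rcons (src r ++ t) c) =
    arc (dst r ++ turn_word (turned r) (rcons t c)).
  move=> cP; rewrite rcons_cat; have et2 : is_edge (src r ++ rcons t c).
    rewrite -rcons_cat edge_rconsE ?edge_neq0 // et (is_blueP _ eb).
    by case: c cP.
  apply: carries_arc => //; first exact: rule_edge.
    rewrite !edge_colour_cat; try by case: (t).
    case: (t) => [|a [|b t']]; rewrite /edge_colour /= ?turn_colour //.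
  by apply: carries_cat => //; case: (t).
rewrite /maps_component !boundary_comp /blue_edge ?et ?et' ?eb ?eb' //.
rewrite image_setU !arcE //; have [t0|t0] := eqVneq t [::].
  rewrite t0 /= cats0 -!cats1; case: (turned r) => //=; exact: setUC.
by rewrite !turn_word_rcons // -!rcons_cat.
Qed.

(** * Checking finite diagrams by computation *)

Definition base_edges : seq word := [:: [:: e_L]; [:: e_R]; [:: e_U]; [:: e_D]].

Definition replace_seq (l : seq word) (e : word) : seq word :=
  [seq a <- l | a != e] ++ [seq rcons e c | c <- replacement (edge_colour e)].

(** The list [es] is a certificate: the edges of the base graph and of its
    expansions to be replaced, in order. *)
Definition expansion_check (es l : seq word) : bool :=
  (fix replaceable (D es : seq word) := match es with
   | [::] => perm_eq D l
   | e :: es' => (e \in D) && replaceable (replace_seq D e) es'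
   end) base_edges es.

Lemma expansion_checkP es l : expansion_check es l -> expansion [set` l].
Proof.
rewrite /expansion_check.
have: expansion [set` base_edges] by exact: expansion_base.
elim: es base_edges => [|e es IH] D eD /=.
  by move=> /perm_mem Dl; rewrite (_ : [set` l] = [set` D]) //; apply/seteqP; split=> a /=; rewrite Dl.
case/andP=> De; apply: IH.
have -> : [set` replace_seq D e] = replace [set` D] e.
  apply/seteqP; split=> a /=; rewrite mem_cat mem_filter.
    by case/orP => [/andP[/eqP nae aD]|/mapP[c cP ->]]; [left|right; exists c].
  case=> [[/= aD /eqP nae]|[c cP <-]]; first by rewrite nae aD.
  by rewrite (map_f (rcons e) cP) orbT.
exact: expansion_replace.
Qed.

Definition rules_check (es es' : seq word) (L : seq rule) : bool :=
  [&& expansion_check es (map src L), expansion_check es' (map dst L),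
      uniq (map src L), uniq (map dst L),
      all (fun r => (is_blue (dst r) == is_blue (src r)) && (turned r ==> is_blue (src r))) L
    & all (fun r => all (fun s => all (fun i => all (fun j =>
        (endpoint (src r) i == endpoint (src s) j) ==
        (endpoint (dst r) (i (+) turned r) == endpoint (dst s) (j (+) turned s)))
        [:: false; true]) [:: false; true]) L) L].

Lemma image_seq (T U : eqType) (h : T -> U) (l : seq T) : h @` [set` l] = [set` map h l].
Proof.
apply/seteqP; split=> [_ [a al <-]|a /mapP[b bl ->]]; last by exists b.
exact: map_f.
Qed.

Lemma uniq_map_in_inj (T U : eqType) (h : T -> U) (l : seq T) : uniq (map h l) ->
  {in l &, injective h}.
Proof.
elim: l => [//|a l IH] /= /andP[al ul] x y; rewrite !inE.
case/predU1P=> [->|xl] /predU1P[->|yl] // E; last exact: IH.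
  by move: al; rewrite E map_f.
by move: al; rewrite -E map_f.
Qed.

Lemma is_blue_colour e e' : is_blue e = is_blue e' -> edge_colour e = edge_colour e'.
Proof. by rewrite /is_blue; case: edge_colour; case: edge_colour. Qed.

Section CheckedRules.
Variables (es es' : seq word) (L : seq rule) (checkL : rules_check es es' L).

Lemma checked_expansions : expansion [set` map src L] /\ expansion [set` map dst L].
Proof. by case/and5P: checkL => /expansion_checkP ? /expansion_checkP. Qed.

Lemma checked_substitution : substitution [set` L].
Proof.
have [eS eD] := checked_expansions.
case/and5P: checkL => _ _ uS uD /andP[/allP okL /allP glueL].
split.
- by rewrite image_seq; exact: expansion_code.
- by rewrite image_seq; exact: expansion_code.
- by move=> r s rL sL; exact: (uniq_map_in_inj uS).
- by move=> r s rL sL; exact: (uniq_map_in_inj uD).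
- move=> r /okL/andP[/eqP cr /implyP br]; split; first exact: is_blue_colour.
  by move/br/is_blueP.
- move=> r s i j rL sL; have bP (b : bool) : b \in [:: false; true] by case: b.
  have /allP/(_ s sL)/allP/(_ i (bP i))/allP/(_ j (bP j))/eqP E := glueL r rL.
  by split=> /eqP; [rewrite E|rewrite -E] => /eqP.
Qed.

Definition rule_map : airplane -> airplane :=
  s2val (cid2 (substitution_realize checked_substitution)).

Lemma rule_map_homeomorphism : homeomorphism rule_map.
Proof. exact: s2valP (cid2 _). Qed.

Lemma rule_map_carries r : r \in L -> carries rule_map r.
Proof. exact: (s2valP' (cid2 (substitution_realize checked_substitution))). Qed.

Lemma checked_coloured r : r \in L -> coloured r.
Proof. by move=> rL; exact: (sb_coloured checked_substitution rL). Qed.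

Lemma checked_src_edge r : r \in L -> is_edge (src r).
Proof. by move=> rL; exact: (sb_src_edge checked_substitution rL). Qed.

Lemma checked_dst_edge r : r \in L -> is_edge (dst r).
Proof. by move=> rL; exact: (sb_dst_edge checked_substitution rL). Qed.

Lemma rule_map_diagram W : (forall r, r \in L -> W r) -> rule_diagram W rule_map [set` L].
Proof.
move=> WL; have [eS eD] := checked_expansions.
have sQ := checked_substitution.
split; rewrite ?image_seq //; [exact: sb_src_inj|exact: sb_dst_inj|].
move=> r rL; split; [exact: checked_coloured|exact: rule_map_carries|exact: WL].
Qed.

Lemma rule_map_move r t : r \in L -> blue_edge (src r ++ t) ->
  maps_component rule_map (comp (src r ++ t)) (comp (dst r ++ turn_word (turned r) t)).
Proof.
move=> rL; apply: rule_maps_component; [exact: rule_map_carries|exact: checked_coloured| |].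
  exact: checked_src_edge.
exact: checked_dst_edge.
Qed.

Lemma blue_edge_move r t : r \in L ->
  blue_edge (dst r ++ turn_word (turned r) t) = blue_edge (src r ++ t).
Proof.
move=> rL; have rok := checked_coloured rL.
have er := checked_src_edge rL; have er' := checked_dst_edge rL.
rewrite /blue_edge rule_blue //; congr (_ && _); apply/idP/idP; last exact: rule_edge.
move/(@rule_edge (inv_rule r) _ (inv_coloured rok) er' er).
rewrite -[dst (inv_rule r)]/(src r) -[turned (inv_rule r)]/(turned r).
by case: t => [|c t] //=; rewrite turnD addbb.
Qed.

Lemma rule_map_arc r : r \in L -> ~~ turned r ->
  rule_map @` arc (src r) = arc (dst r).
Proof.
move=> rL nt; have [cr _] := checked_coloured rL.
apply: carries_arc; [exact: checked_src_edge|exact: checked_dst_edge|by rewrite cr|].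
have : (src r, dst r, false) = r by rewrite -(negbTE nt); case: (r) => [[]].
by move=> ->; exact: rule_map_carries.
Qed.

End CheckedRules.

(** A map given by rules sends every component to a component: either a rule
    applies to the component, or its red edges have been subdivided, which
    happens for finitely many components. *)
Lemma rules_total f (L : seq rule) (S : seq word) : prefix_code [set` map src L] ->
  (forall r, r \in L -> [/\ carries f r, coloured r & is_edge (dst r)]) ->
  all (fun r => all (fun i => blue_edge (take i (src r)) ==> (take i (src r) \in S))
    (iota 0 (size (src r)))) L ->
  (forall e, e \in [::] :: S -> exists C', maps_component f (comp e) C') ->
  forall C, exists C', maps_component f C C'.
Proof.
move=> cL okL /allP inner special C.
have [->|[e eb ->]] := comp_cases C; first by apply: special; rewrite inE eqxx.
have /andP[ee _] := eb.
have [x xE] := Omega_exists (Omega_cat ee (zigzag_ok _)).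
have xe : stream_prefix (stream x) (size e) = e by rewrite xE stream_prefix_cat_stream.
have [edL _ /(_ x)[_ /mapP[r rL ->] xr]] := cL.
have [fr rok er'] := okL r rL.
have er : is_edge (src r) by apply: edL; exact: map_f.
have [le|lt] := leqP (size (src r)) (size e).
  have eE : e = src r ++ drop (size (src r)) e.
    by rewrite -{1}(cat_take_drop (size (src r)) e) -{1}xe take_stream_prefix // xr.
  eexists; rewrite {1}eE; apply: rule_maps_component => //.
  by rewrite -eE.
have eE : e = take (size e) (src r) by rewrite -xr take_stream_prefix ?xe // ltnW.
apply: special; rewrite inE; apply/orP; right.
have /allP/(_ (size e)) := inner r rL; rewrite mem_iota add0n lt -eE.
by move=> /(_ isT) /implyP; apply.
Qed.

(** * Five rearrangements *)

(** On the right ray, parametrized by [0, 1] with [V_r] at 1, this is the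
    generator of Thompson's group F that takes [0, 1/2], [1/2, 3/4], [3/4, 1] to
    [0, 1/4], [1/4, 1/2], [1/2, 1]. A component of the ray sits at each dyadic
    point, and whatever hangs from the component follows it. The edges [b_m] of
    the ray point backwards, which makes one rule turned. *)
Definition push_ray_rules : seq rule :=
  [:: ([:: e_L], [:: e_L], false); ([:: e_U], [:: e_U], false);
      ([:: e_D], [:: e_D], false);
      ([:: e_R; b_m], [:: e_R; b_m; b_p], false);
      ([:: e_R; u_], [:: e_R; b_m; d_], false);
      ([:: e_R; d_], [:: e_R; b_m; u_], false);
      ([:: e_R; b_p; b_m], [:: e_R; b_m; b_m], true);
      ([:: e_R; b_p; u_], [:: e_R; u_], false);
      ([:: e_R; b_p; d_], [:: e_R; d_], false);
      ([:: e_R; b_p; b_p], [:: e_R; b_p], false)].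

Lemma push_ray_check : rules_check [:: [:: e_R]; [:: e_R; b_p]]
  [:: [:: e_R]; [:: e_R; b_m]] push_ray_rules.
Proof. by vm_compute. Qed.

(** The same on the axis from [V_l] to [V_r], parametrized by [0, 1] with the
    central component at 1/2: the outer half of the left ray is fixed, and
    [1/4, 1/2], [1/2, 3/4], [3/4, 1] go to [1/4, 3/8], [3/8, 1/2], [1/2, 1]. *)
Definition push_axis_rules : seq rule :=
  [:: ([:: e_L; b_p], [:: e_L; b_p], false); ([:: e_L; u_], [:: e_L; u_], false);
      ([:: e_L; d_], [:: e_L; d_], false);
      ([:: e_L; b_m], [:: e_L; b_m; b_m], true);
      ([:: e_U], [:: e_L; b_m; u_], false);
      ([:: e_D], [:: e_L; b_m; d_], false);
      ([:: e_R; b_m], [:: e_L; b_m; b_p], true);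
      ([:: e_R; u_], [:: e_U], false);
      ([:: e_R; d_], [:: e_D], false);
      ([:: e_R; b_p], [:: e_R], false)].

Lemma push_axis_check : rules_check [:: [:: e_L]; [:: e_R]]
  [:: [:: e_L]; [:: e_L; b_m]] push_axis_rules.
Proof. by vm_compute. Qed.

(** The first generator of F on the central circle cut open at [V_a]; the rays
    attached to the circle are carried along without change. *)
Definition slide_about_a_rules : seq rule :=
  [:: ([:: e_L], [:: e_L], false); ([:: e_R], [:: e_D; s_], false);
      ([:: e_U; s_], [:: e_R], false); ([:: e_D], [:: e_D; r_1], false);
      ([:: e_U; r_1], [:: e_D; r_2], false); ([:: e_U; r_2], [:: e_U], false)].

Lemma slide_about_a_check : rules_check [:: [:: e_U]] [:: [:: e_D]] slide_about_a_rules.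
Proof. by vm_compute. Qed.

(** The first generator of F on the upper arc of the central circle. *)
Definition slide_on_U_rules : seq rule :=
  [:: ([:: e_L], [:: e_L], false); ([:: e_R], [:: e_R], false);
      ([:: e_D], [:: e_D], false);
      ([:: e_U; r_1], [:: e_U; r_1; r_1], false);
      ([:: e_U; r_2; r_1], [:: e_U; r_1; r_2], false);
      ([:: e_U; r_2; r_2], [:: e_U; r_2], false);
      ([:: e_U; s_], [:: e_U; r_1; s_], false);
      ([:: e_U; r_2; s_], [:: e_U; s_], false)].

Lemma slide_on_U_check : rules_check [:: [:: e_U]; [:: e_U; r_2]]
  [:: [:: e_U]; [:: e_U; r_1]] slide_on_U_rules.
Proof. by vm_compute. Qed.

(** The first generator of F on the central circle cut open at [V_b]. *)
Definition slide_about_b_rules : seq rule :=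
  [:: ([:: e_R], [:: e_R], false); ([:: e_L], [:: e_U; s_], false);
      ([:: e_D; s_], [:: e_L], false); ([:: e_U], [:: e_U; r_1], false);
      ([:: e_D; r_1], [:: e_U; r_2], false); ([:: e_D; r_2], [:: e_D], false)].

Lemma slide_about_b_check : rules_check [:: [:: e_D]] [:: [:: e_U]] slide_about_b_rules.
Proof. by vm_compute. Qed.

Definition push_ray := rule_map push_ray_check.
Definition push_axis := rule_map push_axis_check.
Definition slide_about_a := rule_map slide_about_a_check.
Definition slide_on_U := rule_map slide_on_U_check.
Definition slide_about_b := rule_map slide_about_b_check.

Inductive generator : (airplane -> airplane) -> Prop :=
| generator_push_ray : generator push_ray
| generator_push_axis : generator push_axis
| generator_slide_about_a : generator slide_about_a
| generator_slide_on_U : generator slide_on_U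
| generator_slide_about_b : generator slide_about_b.

Lemma generator_homeomorphism h : generator h -> homeomorphism h.
Proof. by case; exact: rule_map_homeomorphism. Qed.

(** ** Action on the components whose red edges are subdivided *)

Lemma push_ray_central : maps_component push_ray (comp [::]) (comp [::]).
Proof.
rewrite /maps_component boundary_central image_setU.
by rewrite (rule_map_arc push_ray_check (r := ([:: e_U], [:: e_U], false))) //
  (rule_map_arc push_ray_check (r := ([:: e_D], [:: e_D], false))).
Qed.

Lemma push_ray_R : maps_component push_ray (comp [:: e_R]) (comp [:: e_R; b_m]).
Proof.
rewrite /maps_component !boundary_comp // image_setU.
rewrite (rule_map_arc push_ray_check (r := ([:: e_R; u_], [:: e_R; b_m; d_], false))) //
  (rule_map_arc push_ray_check (r := ([:: e_R; d_], [:: e_R; b_m; u_], false))) //.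
exact: setUC.
Qed.

Lemma push_ray_Rp : maps_component push_ray (comp [:: e_R; b_p]) (comp [:: e_R]).
Proof.
rewrite /maps_component !boundary_comp // image_setU.
by rewrite (rule_map_arc push_ray_check (r := ([:: e_R; b_p; u_], [:: e_R; u_], false))) //
  (rule_map_arc push_ray_check (r := ([:: e_R; b_p; d_], [:: e_R; d_], false))).
Qed.

Lemma push_axis_central : maps_component push_axis (comp [::]) (comp [:: e_L; b_m]).
Proof.
rewrite /maps_component boundary_central boundary_comp // image_setU.
by rewrite (rule_map_arc push_axis_check (r := ([:: e_U], [:: e_L; b_m; u_], false))) //
  (rule_map_arc push_axis_check (r := ([:: e_D], [:: e_L; b_m; d_], false))).
Qed.

Lemma push_axis_R : maps_component push_axis (comp [:: e_R]) (comp [::]).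
Proof.
rewrite /maps_component boundary_central boundary_comp // image_setU.
by rewrite (rule_map_arc push_axis_check (r := ([:: e_R; u_], [:: e_U], false))) //
  (rule_map_arc push_axis_check (r := ([:: e_R; d_], [:: e_D], false))).
Qed.

Lemma push_axis_L : maps_component push_axis (comp [:: e_L]) (comp [:: e_L]).
Proof.
rewrite /maps_component !boundary_comp // image_setU.
by rewrite (rule_map_arc push_axis_check (r := ([:: e_L; u_], [:: e_L; u_], false))) //
  (rule_map_arc push_axis_check (r := ([:: e_L; d_], [:: e_L; d_], false))).
Qed.

Lemma slide_about_a_central : maps_component slide_about_a (comp [::]) (comp [::]).
Proof.
rewrite /maps_component boundary_central image_setU (arc_split [:: e_U]) image_setU.
rewrite (rule_map_arc slide_about_a_check (r := ([:: e_U; r_1], [:: e_D; r_2], false))) //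
  (rule_map_arc slide_about_a_check (r := ([:: e_U; r_2], [:: e_U], false))) //
  (rule_map_arc slide_about_a_check (r := ([:: e_D], [:: e_D; r_1], false))) //.
rewrite -arc_split [arc [:: e_D]]arc_split.
by rewrite (setUC (arc [:: e_D; r_2])) -setUA (setUC (arc [:: e_D; r_2])).
Qed.

Lemma slide_on_U_central : maps_component slide_on_U (comp [::]) (comp [::]).
Proof.
rewrite /maps_component boundary_central image_setU (arc_split [:: e_U]) image_setU.
rewrite (rule_map_arc slide_on_U_check (r := ([:: e_U; r_1], [:: e_U; r_1; r_1], false))) //.
rewrite (arc_split (rcons [:: e_U] r_2)) image_setU.
rewrite (rule_map_arc slide_on_U_check (r := ([:: e_U; r_2; r_1], [:: e_U; r_1; r_2], false))) //
  (rule_map_arc slide_on_U_check (r := ([:: e_U; r_2; r_2], [:: e_U; r_2], false))) //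
  (rule_map_arc slide_on_U_check (r := ([:: e_D], [:: e_D], false))) //.
rewrite (arc_split (rcons [:: e_U] r_1)) -!setUA.
by rewrite [in RHS](setUA (arc (rcons (rcons [:: e_U] r_2) r_1))) -arc_split.
Qed.

Lemma slide_about_b_central : maps_component slide_about_b (comp [::]) (comp [::]).
Proof.
rewrite /maps_component boundary_central image_setU (arc_split [:: e_D]) image_setU.
rewrite (rule_map_arc slide_about_b_check (r := ([:: e_D; r_1], [:: e_U; r_2], false))) //
  (rule_map_arc slide_about_b_check (r := ([:: e_D; r_2], [:: e_D], false))) //
  (rule_map_arc slide_about_b_check (r := ([:: e_U], [:: e_U; r_1], false))) //.
by rewrite -arc_split [arc [:: e_U]]arc_split setUA.
Qed.

(** ** The generated group acts on components *)

Lemma checked_total es es' L (chk : rules_check es es' L) S :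
  all (fun r => all (fun i => blue_edge (take i (src r)) ==> (take i (src r) \in S))
    (iota 0 (size (src r)))) L ->
  (forall e, e \in [::] :: S -> exists C', maps_component (rule_map chk) (comp e) C') ->
  forall C, exists C', maps_component (rule_map chk) C C'.
Proof.
apply: rules_total; first exact/expansion_code/(checked_expansions chk).1.
move=> r rL; split; first exact: rule_map_carries.
  exact: (checked_coloured chk).
exact: (checked_dst_edge chk).
Qed.

Lemma checked_total_inv es es' L (chk : rules_check es es' L) g S :
  inverse_maps (rule_map chk) g ->
  all (fun r => all (fun i => blue_edge (take i (dst r)) ==> (take i (dst r) \in S))
    (iota 0 (size (dst r)))) L ->
  (forall e, e \in [::] :: S -> exists C, maps_component (rule_map chk) C (comp e)) ->
  forall C', exists C, maps_component (rule_map chk) C C'.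
Proof.
move=> fg inner special C'.
have gf : inverse_maps g (rule_map chk) by case: fg.
suff [C gC] : exists C, maps_component g C' C by exists C; exact: maps_component_inv gf gC.
apply: (@rules_total g [seq inv_rule r | r <- L] S).
- rewrite -map_comp; exact/expansion_code/(checked_expansions chk).2.
- move=> _ /mapP[r rL ->]; split.
  + by apply: carries_inv fg _; exact: rule_map_carries.
  + exact/inv_coloured/(checked_coloured chk).
  + exact: (checked_src_edge chk).
- by rewrite all_map.
- by move=> e /special[C fC]; exists C; exact: maps_component_inv fg fC.
Qed.

Lemma generator_total h : generator h -> forall C, exists C', maps_component h C C'.
Proof.
case.
- apply: (checked_total (S := [:: [:: e_R]; [:: e_R; b_p]])); first by vm_compute.
  move=> e; rewrite !inE => /or3P[] /eqP ->.
  + by eexists; exact: push_ray_central.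
  + by eexists; exact: push_ray_R.
  + by eexists; exact: push_ray_Rp.
- apply: (checked_total (S := [:: [:: e_L]; [:: e_R]])); first by vm_compute.
  move=> e; rewrite !inE => /or3P[] /eqP ->.
  + by eexists; exact: push_axis_central.
  + by eexists; exact: push_axis_L.
  + by eexists; exact: push_axis_R.
- apply: (checked_total (S := [::])); first by vm_compute.
  by move=> e; rewrite inE => /eqP ->; eexists; exact: slide_about_a_central.
- apply: (checked_total (S := [::])); first by vm_compute.
  by move=> e; rewrite inE => /eqP ->; eexists; exact: slide_on_U_central.
- apply: (checked_total (S := [::])); first by vm_compute.
  by move=> e; rewrite inE => /eqP ->; eexists; exact: slide_about_b_central.
Qed.

Lemma generator_total_inv h : generator h -> forall C', exists C, maps_component h C C'.
Proof.
move=> gh; have [_ [g _ hg]] := generator_homeomorphism gh; case: gh hg.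
- move=> hg; apply: (checked_total_inv (S := [:: [:: e_R]; [:: e_R; b_m]]) hg); first by vm_compute.
  move=> e; rewrite !inE => /or3P[] /eqP ->.
  + by eexists; exact: push_ray_central.
  + by eexists; exact: push_ray_Rp.
  + by eexists; exact: push_ray_R.
- move=> hg; apply: (checked_total_inv (S := [:: [:: e_L]; [:: e_L; b_m]]) hg); first by vm_compute.
  move=> e; rewrite !inE => /or3P[] /eqP ->.
  + by eexists; exact: push_axis_R.
  + by eexists; exact: push_axis_L.
  + by eexists; exact: push_axis_central.
- move=> hg; apply: (checked_total_inv (S := [::]) hg); first by vm_compute.
  by move=> e; rewrite inE => /eqP ->; eexists; exact: slide_about_a_central.
- move=> hg; apply: (checked_total_inv (S := [::]) hg); first by vm_compute.
  by move=> e; rewrite inE => /eqP ->; eexists; exact: slide_on_U_central.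
- move=> hg; apply: (checked_total_inv (S := [::]) hg); first by vm_compute.
  by move=> e; rewrite inE => /eqP ->; eexists; exact: slide_about_b_central.
Qed.

Inductive generated : (airplane -> airplane) -> Prop :=
| generated_id : generated id
| generated_gen f h : generated f -> generator h -> generated (h \o f)
| generated_inv f h h' : generated f -> generator h -> inverse_maps h h' ->
    generated (h' \o f).

Lemma generated_comp f g : generated f -> generated g -> generated (g \o f).
Proof.
move=> Gf; elim=> [//|{}g h _ Ggf gh|{}g h h' _ Ggf gh hh'].
  exact: (generated_gen Ggf gh).
exact: (generated_inv Ggf gh hh').
Qed.

Lemma inverse_maps_sym f g : inverse_maps f g -> inverse_maps g f.
Proof. by case. Qed.

Lemma inverse_maps_comp f f' g g' : inverse_maps f f' -> inverse_maps g g' ->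
  inverse_maps (g \o f) (f' \o g').
Proof. by move=> [fK f'K] [gK g'K]; split; [exact: can_comp gK fK|exact: can_comp f'K g'K]. Qed.

Lemma generated_inverse f : generated f -> exists2 g, generated g & inverse_maps f g.
Proof.
elim=> [|{}f h _ [g Gg fg] gh|{}f h h' _ [g Gg fg] gh hh'].
- by exists id => //; exact: generated_id.
- have [_ [h' _ hh']] := generator_homeomorphism gh.
  exists (g \o h'); last exact: inverse_maps_comp.
  by apply: generated_comp Gg; exact: (generated_inv generated_id gh hh').
- exists (g \o h); last exact: inverse_maps_comp fg (inverse_maps_sym hh').
  by apply: generated_comp Gg; exact: (generated_gen generated_id gh).
Qed.

Lemma maps_component_id C : maps_component id C C.
Proof. by rewrite /maps_component image_id. Qed.

Lemma generated_total f : generated f -> forall C, exists C', maps_component f C C'.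
Proof.
elim=> [|{}f h _ IH gh|{}f h h' _ IH gh hh'] C; first by exists C; exact: maps_component_id.
  have [C1 fC] := IH C; have [C2 hC] := generator_total gh C1.
  by exists C2; exact: maps_component_comp fC hC.
have [C1 fC] := IH C; have [C2 hC] := generator_total_inv gh C1.
by exists C2; apply: maps_component_comp fC _; exact: maps_component_inv hh' hC.
Qed.

Definition reach (P Q P' Q' : component) : Prop :=
  exists2 f, generated f & maps_component f P P' /\ maps_component f Q Q'.

Lemma reach_refl P Q : reach P Q P Q.
Proof. by exists id; [exact: generated_id|split; exact: maps_component_id]. Qed.

Lemma reach_trans P Q P1 Q1 P2 Q2 : reach P Q P1 Q1 -> reach P1 Q1 P2 Q2 -> reach P Q P2 Q2.
Proof.
move=> [f Gf [fP fQ]] [g Gg [gP gQ]]; exists (g \o f); first exact: generated_comp.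
by split; [exact: maps_component_comp fP gP|exact: maps_component_comp fQ gQ].
Qed.

Lemma reach_sym P Q P' Q' : reach P Q P' Q' -> reach P' Q' P Q.
Proof.
move=> [f Gf [fP fQ]]; have [g Gg fg] := generated_inverse Gf.
by exists g => //; split; exact: maps_component_inv fg _.
Qed.

Lemma reach_generator h P Q P' Q' : generator h -> maps_component h P P' ->
  maps_component h Q Q' -> reach P Q P' Q'.
Proof.
move=> gh hP hQ; exists h => //; exact: (generated_gen generated_id gh).
Qed.

Lemma reach_rule es es' L (chk : rules_check es es' L) C C' r t :
  generator (rule_map chk) -> maps_component (rule_map chk) C C' -> r \in L ->
  blue_edge (src r ++ t) ->
  reach C (comp (src r ++ t)) C' (comp (dst r ++ turn_word (turned r) t)) /\
  blue_edge (dst r ++ turn_word (turned r) t).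
Proof.
move=> gh hC rL eb; split; last by rewrite (blue_edge_move chk).
by apply: reach_generator gh hC _; exact: rule_map_move.
Qed.

Lemma reach_rule_inv es es' L (chk : rules_check es es' L) C C' r t :
  generator (rule_map chk) -> maps_component (rule_map chk) C C' -> r \in L ->
  blue_edge (dst r ++ turn_word (turned r) t) ->
  reach C' (comp (dst r ++ turn_word (turned r) t)) C (comp (src r ++ t)) /\
  blue_edge (src r ++ t).
Proof.
move=> gh hC rL; rewrite (blue_edge_move chk) // => eb; split=> //.
apply: reach_sym; apply: reach_generator gh hC _; exact: rule_map_move.
Qed.

Lemma turn_word0 t : turn_word false t = t.
Proof. by case: t. Qed.

Lemma turn_wordK b t : turn_word b (turn_word b t) = t.
Proof. by case: t => [//|c t] /=; rewrite turnD addbb. Qed.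

Lemma size_turn_word b t : size (turn_word b t) = size t.
Proof. by case: t. Qed.

Lemma reach_prefix es es' L (chk : rules_check es es' L) C C' a b t :
  generator (rule_map chk) -> maps_component (rule_map chk) C C' ->
  (a, b, false) \in L -> blue_edge (a ++ t) ->
  reach C (comp (a ++ t)) C' (comp (b ++ t)) /\ blue_edge (b ++ t).
Proof.
move=> gh hC rL eb; have := reach_rule gh hC rL eb.
by rewrite turn_word0.
Qed.

Lemma reach_prefix_inv es es' L (chk : rules_check es es' L) C C' a b t :
  generator (rule_map chk) -> maps_component (rule_map chk) C C' ->
  (a, b, false) \in L -> blue_edge (b ++ t) ->
  reach C' (comp (b ++ t)) C (comp (a ++ t)) /\ blue_edge (a ++ t).
Proof.
move=> gh hC rL eb; have := @reach_rule_inv _ _ _ chk _ _ (a, b, false) t gh hC rL.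
by rewrite /turned /= turn_word0; apply.
Qed.

(** ** Two-transitivity of the generated group *)

(** The maps of the central circle shorten words that begin with [e_U] or [e_D]
    until they fall into the right ray; only the passage from [e_D r_2] to
    [e_U r_1] keeps the length, and it leads to a case that shortens. *)
Lemma circle_to_ray C e : maps_component slide_about_a C C -> maps_component slide_on_U C C ->
  blue_edge e -> head e_L e \in [:: e_U; e_D] ->
  exists t, [/\ blue_edge (e_R :: t), size (e_R :: t) < size e
              & reach C (comp e) C (comp (e_R :: t))].
Proof.
move=> C0 C1; have [n] := ubnP (size e); elim: n e => [//|n IH].
pose goal e := exists t, [/\ blue_edge (e_R :: t), size (e_R :: t) < size e
              & reach C (comp e) C (comp (e_R :: t))].
have step e e' : size e <= n -> size e' < size e -> head e_L e' \in [:: e_U; e_D] ->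
    reach C (comp e) C (comp e') /\ blue_edge e' -> goal e.
  move=> en e'e he' [ee' eb']; have [t [tb te' rt]] := IH e' (leq_trans e'e en) eb' he'.
  by exists t; split=> //; [exact: ltn_trans te' e'e|exact: reach_trans ee' rt].
have g0 := generator_slide_about_a; have g1 := generator_slide_on_U.
have upper t : size [:: e_U, r_1 & t] <= n -> blue_edge [:: e_U, r_1 & t] ->
    goal [:: e_U, r_1 & t].
  case: t => [//|a t] en; case: a en => // en eb.
  - apply: (step _ (e_U :: r_1 :: t)) => //.
    exact: (reach_prefix_inv (a := [:: e_U; r_1]) (b := [:: e_U; r_1; r_1]) g1 C1).
  - have [s1 eb1] := reach_prefix_inv (a := [:: e_U; r_2; r_1]) (b := [:: e_U; r_1; r_2])
      g1 C1 isT eb.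
    have [s2 eb2] := reach_prefix (a := [:: e_U; r_2]) (b := [:: e_U]) (t := r_1 :: t) g0 C0 isT eb1.
    by apply: (step _ (e_U :: r_1 :: t)) => //; split=> //; exact: reach_trans s1 s2.
  - apply: (step _ (e_U :: s_ :: t)) => //.
    exact: (reach_prefix_inv (a := [:: e_U; s_]) (b := [:: e_U; r_1; s_]) g1 C1).
move=> e; rewrite ltnS => en eb; rewrite -/(goal e).
case: e en eb => [//|a e] en eb; rewrite /= !inE => /orP[] /eqP ?; subst a; case: e en eb => [//|a e] en eb.
  case: a en eb => // en eb.
  - exact: upper.
  - apply: (step _ (e_U :: e)) => //.
    exact: (reach_prefix (a := [:: e_U; r_2]) (b := [:: e_U]) g0 C0).
  - have [s1 eb1] := reach_prefix (a := [:: e_U; s_]) (b := [:: e_R]) g0 C0 isT eb.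
    by exists e; split.
case: a en eb => // en eb.
- apply: (step _ (e_D :: e)) => //.
  exact: (reach_prefix_inv (a := [:: e_D]) (b := [:: e_D; r_1]) g0 C0).
- have [s1 eb1] := reach_prefix_inv (a := [:: e_U; r_1]) (b := [:: e_D; r_2]) g0 C0 isT eb.
  have [t [tb te rt]] := upper e en eb1.
  by exists t; split=> //; exact: reach_trans s1 rt.
- have [s1 eb1] := reach_prefix_inv (a := [:: e_R]) (b := [:: e_D; s_]) g0 C0 isT eb.
  by exists e; split.
Qed.

Lemma central_to_ray e : blue_edge e -> exists t, [/\ blue_edge (e_R :: t),
  size (e_R :: t) <= size e & reach (comp [::]) (comp e) (comp [::]) (comp (e_R :: t))].
Proof.
case: e => [//|a t] eb; have : a \in [:: e_L; e_R; e_U; e_D] by case: a eb.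
have c0 := slide_about_a_central; have c1 := slide_on_U_central; have c2 := slide_about_b_central.
rewrite !inE => /or4P[] /eqP ?; subst a.
- have [s1 eb1] := reach_prefix (a := [:: e_L]) (b := [:: e_U; s_]) generator_slide_about_b c2 isT eb.
  have [s2 eb2] := reach_prefix (a := [:: e_U; s_]) (b := [:: e_R]) generator_slide_about_a c0 isT eb1.
  by exists t; split=> //; exact: reach_trans s1 s2.
- by exists t; split=> //; exact: reach_refl.
- by have [t' [tb /ltnW le rt]] := circle_to_ray c0 c1 eb isT; exists t'.
- by have [t' [tb /ltnW le rt]] := circle_to_ray c0 c1 eb isT; exists t'.
Qed.

(** Induction on the length of the word. Most words are shortened by maps that fix
    the central component. For [e_R b_p b_m t], [e_R u_ t] and [e_R d_ t], the map
    [push_axis] first moves the central component to a component of the left ray,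
    which [push_ray], [slide_about_a] and [slide_on_U] fix; they shorten the
    second word, and [push_axis] is undone. *)
Lemma central_transitive e : blue_edge e ->
  reach (comp [::]) (comp e) (comp [::]) (comp [:: e_R]).
Proof.
have [n] := ubnP (size e); elim: n e => [//|n IH] e; rewrite ltnS => en eb.
have [t [tb te rt]] := central_to_ray eb; apply: reach_trans rt _.
have {te en} tn : size (e_R :: t) <= n by exact: leq_trans te en.
move: t tb tn => {e eb} t tb tn.
have gr := generator_push_ray; have ga := generator_push_axis.
have kc := push_ray_central; have ac := push_axis_central.
pose X := comp [:: e_L; b_m].
have kX : maps_component push_ray X X.
  exact: (rule_map_move push_ray_check (r := ([:: e_L], [:: e_L], false)) (t := [:: b_m])).
have xX0 : maps_component slide_about_a X X.
  exact: (rule_map_move slide_about_a_check (r := ([:: e_L], [:: e_L], false)) (t := [:: b_m])).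
have xX1 : maps_component slide_on_U X X.
  exact: (rule_map_move slide_on_U_check (r := ([:: e_L], [:: e_L], false)) (t := [:: b_m])).
pose goal e := reach (comp [::]) (comp e) (comp [::]) (comp [:: e_R]).
have step e e' : size e <= n -> size e' < size e ->
    reach (comp [::]) (comp e) (comp [::]) (comp e') /\ blue_edge e' -> goal e.
  by move=> le lt [r eb]; apply: reach_trans r (IH e' _ eb); exact: leq_trans lt le.
(* conjugation by [push_axis]: it takes the prefix [a] to [e1]; beside [X], the
   word becomes [e_R t2]; undoing [push_axis] inserts [b_p] after [e_R] *)
have detour a t1 t2 e1 : (a, e1, false) \in push_axis_rules ->
    size (a ++ t1) <= n -> blue_edge (a ++ t1) -> size [:: e_R, b_p & t2] < size (a ++ t1) ->
    (blue_edge (e1 ++ t1) ->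
       reach X (comp (e1 ++ t1)) X (comp (e_R :: t2)) /\ blue_edge (e_R :: t2)) ->
    goal (a ++ t1).
  move=> aP le eb lt mid; have [s1 eb1] := reach_prefix ga ac aP eb.
  have [s2 eb2] := mid eb1.
  have [s3 eb3] := reach_prefix_inv (a := [:: e_R; b_p]) (b := [:: e_R]) ga ac isT eb2.
  apply: (step _ _ le lt); split=> //.
  exact: reach_trans s1 (reach_trans s2 s3).
have pm t1 : size [:: e_R, b_p, b_m & t1] <= n -> blue_edge [:: e_R, b_p, b_m & t1] ->
    goal [:: e_R, b_p, b_m & t1].
  case: t1 => [|a t1] le eb.
    apply: (detour [:: e_R; b_p] [:: b_m] [::] [:: e_R]) => // _; split=> //.
    by apply: reach_sym; apply: reach_generator gr kX push_ray_R.
  case: a le eb => // le eb.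
  - have [s1 eb1] : reach (comp [::]) (comp [:: e_R, b_p, b_m, b_m & t1])
       (comp [::]) (comp [:: e_R, b_p, b_p, b_m & turn_word true t1]) /\
       blue_edge [:: e_R, b_p, b_p, b_m & turn_word true t1].
      have [s1 eb1] := reach_prefix (a := [:: e_R; b_p]) (b := [:: e_R]) (t := [:: b_m, b_m & t1]) ga ac isT eb.
      have [|s2 eb2] := reach_rule_inv (chk := push_ray_check)
        (r := ([:: e_R; b_p; b_m], [:: e_R; b_m; b_m], true)) (t := turn_word true t1) gr kX isT.
        by rewrite turn_wordK.
      rewrite turn_wordK in s2.
      have [s3 eb3] := reach_prefix_inv (a := [:: e_R; b_p]) (b := [:: e_R])
        (t := [:: b_p, b_m & turn_word true t1]) ga ac isT eb2.
      by split=> //; exact: reach_trans s1 (reach_trans s2 s3).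
    have [s2 eb2] := reach_prefix (a := [:: e_R; b_p; b_p]) (b := [:: e_R; b_p])
      (t := b_m :: turn_word true t1) gr kc isT eb1.
    apply: (step _ [:: e_R, b_p, b_m & turn_word true t1]) => //.
      by rewrite /= size_turn_word.
    by split=> //; exact: reach_trans s1 s2.
  - apply: (detour [:: e_R; b_p] [:: b_m, b_p & t1] (b_m :: t1) [:: e_R]) => // eb1.
    exact: (reach_prefix_inv (a := [:: e_R; b_m]) (b := [:: e_R; b_m; b_p]) gr kX).
  - apply: (detour [:: e_R; b_p] [:: b_m, u_ & t1] (d_ :: t1) [:: e_R]) => // eb1.
    exact: (reach_prefix_inv (a := [:: e_R; d_]) (b := [:: e_R; b_m; u_]) gr kX).
  - apply: (detour [:: e_R; b_p] [:: b_m, d_ & t1] (u_ :: t1) [:: e_R]) => // eb1.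
    exact: (reach_prefix_inv (a := [:: e_R; u_]) (b := [:: e_R; b_m; d_]) gr kX).
have arc_case a c t1 : (a, [:: c], false) \in push_axis_rules -> c \in [:: e_U; e_D] ->
    size a = 2 -> size (a ++ t1) <= n -> blue_edge (a ++ t1) -> goal (a ++ t1).
  move=> aP cP a2 le eb.
  have [_ eb1] := reach_prefix ga ac aP eb.
  have [t2 [eb2 lt r]] := circle_to_ray xX0 xX1 eb1 cP.
  apply: (detour a t1 t2 [:: c]) => //.
  by move: lt; rewrite size_cat a2 /= !ltnS.
case: t tb tn => [|a t] tb tn; first exact: reach_refl.
case: a tb tn => // tb tn.
- case: t tb tn => [|a t] tb tn; first exact/reach_sym/(reach_generator gr kc)/push_ray_R.
  case: a tb tn => // tb tn.
  + have [|s1 eb1] := reach_rule_inv (chk := push_ray_check)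
      (r := ([:: e_R; b_p; b_m], [:: e_R; b_m; b_m], true)) (t := turn_word true t) gr kc isT.
      by rewrite turn_wordK.
    rewrite turn_wordK in s1; apply: reach_trans s1 (pm _ _ eb1).
    by rewrite /= size_turn_word.
  + apply: (step _ [:: e_R, b_m & t]) => //.
    exact: (reach_prefix_inv (a := [:: e_R; b_m]) (b := [:: e_R; b_m; b_p]) gr kc).
  + apply: (step _ [:: e_R, d_ & t]) => //.
    exact: (reach_prefix_inv (a := [:: e_R; d_]) (b := [:: e_R; b_m; u_]) gr kc).
  + apply: (step _ [:: e_R, u_ & t]) => //.
    exact: (reach_prefix_inv (a := [:: e_R; u_]) (b := [:: e_R; b_m; d_]) gr kc).
- case: t tb tn => [|a t] tb tn; first exact: reach_generator gr kc push_ray_Rp.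
  case: a tb tn => // tb tn.
  + exact: pm.
  + apply: (step _ [:: e_R, b_p & t]) => //.
    exact: (reach_prefix (a := [:: e_R; b_p; b_p]) (b := [:: e_R; b_p]) gr kc).
  + apply: (step _ [:: e_R, u_ & t]) => //.
    exact: (reach_prefix (a := [:: e_R; b_p; u_]) (b := [:: e_R; u_]) gr kc).
  + apply: (step _ [:: e_R, d_ & t]) => //.
    exact: (reach_prefix (a := [:: e_R; b_p; d_]) (b := [:: e_R; d_]) gr kc).
- exact: (arc_case [:: e_R; u_] e_U).
- exact: (arc_case [:: e_R; d_] e_D).
Qed.

Lemma reach_standard P Q : P <> Q -> reach P Q (comp [::]) (comp [:: e_R]).
Proof.
move=> PQ.
have [Q' r QC] : exists2 Q', reach P Q (comp [::]) Q' & Q' <> comp [::].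
  have [P0|[e eb Pe]] := comp_cases P.
    by exists Q; [rewrite -P0; exact: reach_refl|rewrite -P0; exact: nesym].
  have [f Gf [_ fe]] := central_transitive eb; rewrite -Pe in fe.
  pose h := push_axis \o f.
  have Gh : generated h := generated_gen Gf generator_push_axis.
  have hP : maps_component h P (comp [::]) := maps_component_comp fe push_axis_R.
  have [Q' hQ] := generated_total Gh Q.
  exists Q'; first by exists h.
  move=> Q'C; subst Q'; apply: PQ; have [g _ hg] := generated_inverse Gh.
  apply: boundary_inj.
  by rewrite -(maps_component_inv hg hP) -(maps_component_inv hg hQ).
apply: reach_trans r _; have [//|[e eb ->]] := comp_cases Q'.
exact: central_transitive.
Qed.

Lemma reach_pairs P Q P' Q' : P <> Q -> P' <> Q' -> reach P Q P' Q'.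
Proof.
move=> PQ PQ'; exact: reach_trans (reach_standard PQ) (reach_sym (reach_standard PQ')).
Qed.

(** * Correction of the extremal derivative *)

Lemma homeomorphism_comp f g : homeomorphism f -> homeomorphism g -> homeomorphism (g \o f).
Proof.
move=> [cf [f' cf' ff']] [cg [g' cg' gg']]; split.
  by move=> x; apply: continuous_comp; [exact: cf|exact: cg].
exists (f' \o g'); last exact: inverse_maps_comp.
by move=> x; apply: continuous_comp; [exact: cg'|exact: cf'].
Qed.

Lemma inverse_maps_uniq f g g' : inverse_maps f g -> inverse_maps f g' -> g = g'.
Proof. by move=> [fK gK] [fK' gK']; apply: funext => p; rewrite -{1}(gK' p) fK. Qed.

Lemma homeomorphism_inv f g : inverse_maps f g -> homeomorphism f -> homeomorphism g.
Proof.
move=> fg [cf [g' cg fg']]; rewrite (inverse_maps_uniq fg fg').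
by split=> //; exists f => //; exact: inverse_maps_sym.
Qed.

Definition length_preserving (f : airplane -> airplane) : Prop :=
  homeomorphism f /\ exists Q, rule_diagram preserves_length f Q.

(** Length preserving except at [V_r], which is fixed. *)
Definition right_shift (s : int) (f : airplane -> airplane) : Prop :=
  homeomorphism f /\ exists Q, rule_diagram (shifts_right_end s) f Q.

Lemma length_preserving_comp f g : length_preserving f -> length_preserving g ->
  length_preserving (g \o f).
Proof.
move=> [hf [Q dQ]] [hg [P dP]]; split; first exact: homeomorphism_comp.
apply: rule_diagram_comp dQ dP; try exact: preserves_length_stable.
by move=> r s _ _; exact: preserves_length_comp.
Qed.

Lemma length_preserving_inv f g : inverse_maps f g -> length_preserving f ->
  length_preserving g.
Proof.
move=> fg [hf [Q dQ]]; split; first exact: homeomorphism_inv fg hf.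
exists (inv_rule @` Q); apply: rule_diagram_inv fg _ dQ.
by move=> r _; exact: preserves_length_inv.
Qed.

Lemma right_shift_comp s s' f g : right_shift s f -> right_shift s' g ->
  right_shift (s + s')%R (g \o f).
Proof.
move=> [hf [Q dQ]] [hg [P dP]]; split; first exact: homeomorphism_comp.
apply: rule_diagram_comp dQ dP; try exact: shifts_right_end_stable.
by move=> r r' _ _; exact: shifts_right_end_comp.
Qed.

Lemma right_shift_inv s f g : inverse_maps f g -> right_shift s f -> right_shift (- s)%R g.
Proof.
move=> fg [hf [Q dQ]]; split; first exact: homeomorphism_inv fg hf.
exists (inv_rule @` Q); apply: rule_diagram_inv fg _ dQ.
by move=> r _; exact: shifts_right_end_inv.
Qed.

Lemma right_shift0 f : right_shift 0%R f -> length_preserving f.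
Proof.
move=> [hf [Q dQ]]; split=> //; exists Q; case: dQ => a b c d H.
by split=> // r /H[? ? /shifts_right_end0].
Qed.

Lemma push_ray_shift : right_shift (- 1)%R push_ray.
Proof.
split; first exact: rule_map_homeomorphism.
exists [set` push_ray_rules]; apply: rule_map_diagram => r.
by rewrite !inE; do ![case/predU1P=> [->|]] => // /eqP ->.
Qed.

Lemma push_axis_shift : right_shift (- 1)%R push_axis.
Proof.
split; first exact: rule_map_homeomorphism.
exists [set` push_axis_rules]; apply: rule_map_diagram => r.
by rewrite !inE; do ![case/predU1P=> [->|]] => // /eqP ->.
Qed.

Lemma slide_about_a_length : length_preserving slide_about_a.
Proof.
split; first exact: rule_map_homeomorphism.
exists [set` slide_about_a_rules]; apply: rule_map_diagram => r.
by rewrite !inE; do ![case/predU1P=> [->|]] => // /eqP ->.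
Qed.

Lemma slide_on_U_length : length_preserving slide_on_U.
Proof.
split; first exact: rule_map_homeomorphism.
exists [set` slide_on_U_rules]; apply: rule_map_diagram => r.
by rewrite !inE; do ![case/predU1P=> [->|]] => // /eqP ->.
Qed.

Lemma slide_about_b_length : length_preserving slide_about_b.
Proof.
split; first exact: rule_map_homeomorphism.
exists [set` slide_about_b_rules]; apply: rule_map_diagram => r.
by rewrite !inE; do ![case/predU1P=> [->|]] => // /eqP ->.
Qed.

Fixpoint leaves_right_ray (m : nat) (P : component) : Prop :=
  if m is m'.+1 then exists2 P', maps_component push_axis P P' & leaves_right_ray m' P'
  else P = comp [::] \/ exists e, [/\ blue_edge e, head e_R e != e_R & P = comp e].

Lemma push_axis_move r t : r \in push_axis_rules -> blue_edge (src r ++ t) ->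
  maps_component push_axis (comp (src r ++ t)) (comp (dst r ++ turn_word (turned r) t)) /\
  blue_edge (dst r ++ turn_word (turned r) t).
Proof.
by move=> rL eb; split; [exact: rule_map_move|rewrite (blue_edge_move push_axis_check)].
Qed.

Lemma leaves_right_rayS m P : leaves_right_ray m P -> leaves_right_ray m.+1 P.
Proof.
elim: m P => [|m IH] P; last first.
  by move=> [P' PP' /IH rP']; exists P'.
case=> [->|[e [eb he ->]]].
  exists (comp [:: e_L; b_m]); first exact: push_axis_central.
  by right; exists [:: e_L; b_m].
case: e eb he => [//|a t] eb he; case: a eb he => // eb _.
- case: t eb => [|a t] eb.
    by exists (comp [:: e_L]); [exact: push_axis_L|right; exists [:: e_L]].
  case: a eb => // eb.
  + have [h eb'] := push_axis_move (r := ([:: e_L; b_m], [:: e_L; b_m; b_m], true)) isT eb.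
    by eexists; [exact: h|right; eexists; split; [exact: eb'| |]].
  + have [h eb'] := push_axis_move (r := ([:: e_L; b_p], [:: e_L; b_p], false)) isT eb.
    by eexists; [exact: h|right; eexists; split; [exact: eb'| |]].
  + have [h eb'] := push_axis_move (r := ([:: e_L; u_], [:: e_L; u_], false)) isT eb.
    by eexists; [exact: h|right; eexists; split; [exact: eb'| |]].
  + have [h eb'] := push_axis_move (r := ([:: e_L; d_], [:: e_L; d_], false)) isT eb.
    by eexists; [exact: h|right; eexists; split; [exact: eb'| |]].
- have [h eb'] := push_axis_move (r := ([:: e_U], [:: e_L; b_m; u_], false)) isT eb.
  by eexists; [exact: h|right; eexists; split; [exact: eb'| |]].
- have [h eb'] := push_axis_move (r := ([:: e_D], [:: e_L; b_m; d_], false)) isT eb.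
  by eexists; [exact: h|right; eexists; split; [exact: eb'| |]].
Qed.

Lemma leaves_right_rayD m k P : leaves_right_ray m P -> leaves_right_ray (m + k) P.
Proof. by elim: k => [|k IH]; rewrite ?addn0 // addnS => /IH/leaves_right_rayS. Qed.

Lemma leaves_right_ray_exists P : exists m, leaves_right_ray m P.
Proof.
have [->|[e eb ->]] := comp_cases P; first by exists 0; left.
case: e eb => [//|a t] eb; have [aR|aR] := eqVneq a e_R; last first.
  by exists 0; right; exists (a :: t).
subst a; elim: t eb => [|a t IH] eb.
  by exists 1, (comp [::]); [exact: push_axis_R|left].
case: a eb => // eb.
- have [h eb'] := push_axis_move (r := ([:: e_R; b_m], [:: e_L; b_m; b_p], true)) isT eb.
  by exists 1; eexists; [exact: h|right; eexists; split; [exact: eb'| |]].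
- have [h eb'] := push_axis_move (r := ([:: e_R; b_p], [:: e_R], false)) isT eb.
  rewrite turn_word0 in h eb'; have [m rm] := IH eb'.
  by exists m.+1; eexists; [exact: h|].
- have [h eb'] := push_axis_move (r := ([:: e_R; u_], [:: e_U], false)) isT eb.
  by exists 1; eexists; [exact: h|right; eexists; split; [exact: eb'| |]].
- have [h eb'] := push_axis_move (r := ([:: e_R; d_], [:: e_D], false)) isT eb.
  by exists 1; eexists; [exact: h|right; eexists; split; [exact: eb'| |]].
Qed.

Lemma push_ray_away P : leaves_right_ray 0 P -> maps_component push_ray P P.
Proof.
case=> [->|[e [eb he ->]]]; first exact: push_ray_central.
case: e eb he => [//|a t] eb he; case: a eb he => // eb _.
- have := rule_map_move push_ray_check (r := ([:: e_L], [:: e_L], false)) isT eb.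
  by rewrite turn_word0.
- have := rule_map_move push_ray_check (r := ([:: e_U], [:: e_U], false)) isT eb.
  by rewrite turn_word0.
- have := rule_map_move push_ray_check (r := ([:: e_D], [:: e_D], false)) isT eb.
  by rewrite turn_word0.
Qed.

(** Conjugates of [push_ray] by powers of [push_axis] are supported arbitrarily
    close to [V_r], so they fix any two given components. *)
Lemma local_shift P Q : exists g, [/\ right_shift (- 1)%R g,
  maps_component g P P & maps_component g Q Q].
Proof.
have [m [rP rQ]] : exists m, leaves_right_ray m P /\ leaves_right_ray m Q.
  have [m rP] := leaves_right_ray_exists P; have [n rQ] := leaves_right_ray_exists Q.
  by exists (m + n)%N; split; [exact: leaves_right_rayD|rewrite addnC; exact: leaves_right_rayD].
elim: m P Q rP rQ => [|m IH] P Q rP rQ.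
  exists push_ray; split; [exact: push_ray_shift|exact: push_ray_away|exact: push_ray_away].
have [P' PP' rP'] := rP; have [Q' QQ' rQ'] := rQ.
have [g [sg gP gQ]] := IH P' Q' rP' rQ'.
have [_ [h _ hh']] := generator_homeomorphism generator_push_axis.
exists (h \o (g \o push_axis)); split.
- have := right_shift_comp (right_shift_comp push_axis_shift sg)
    (right_shift_inv hh' push_axis_shift).
  by rewrite GRing.opprK GRing.subrK.
- exact: maps_component_comp (maps_component_comp PP' gP) (maps_component_inv hh' PP').
- exact: maps_component_comp (maps_component_comp QQ' gQ) (maps_component_inv hh' QQ').
Qed.

(** Composing with the inverse of a shift supported close to [V_r] restores the
    lengths there and does not touch the pair. *)
Lemma generator_length_preserving h P Q P' Q' : generator h -> maps_component h P P' ->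
  maps_component h Q Q' ->
  exists f, [/\ length_preserving f, maps_component f P P' & maps_component f Q Q'].
Proof.
move=> gh hP hQ.
have corrected : right_shift (- 1)%R h ->
    exists f, [/\ length_preserving f, maps_component f P P' & maps_component f Q Q'].
  move=> sh; have [g [sg gP gQ]] := local_shift P Q.
  have [_ [g' _ gg']] := sg.1.
  exists (h \o g'); split.
  - apply: right_shift0; have := right_shift_comp (right_shift_inv gg' sg) sh.
    by rewrite GRing.opprK GRing.subrr.
  - exact: maps_component_comp (maps_component_inv gg' gP) hP.
  - exact: maps_component_comp (maps_component_inv gg' gQ) hQ.
case: gh corrected hP hQ => corrected hP hQ.
- exact/corrected/push_ray_shift.
- exact/corrected/push_axis_shift.
- by exists slide_about_a; split=> //; exact: slide_about_a_length.
- by exists slide_on_U; split=> //; exact: slide_on_U_length.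
- by exists slide_about_b; split=> //; exact: slide_about_b_length.
Qed.

Lemma length_preserving_subgroup : subgroup length_preserving.
Proof.
split; first last.
- by move=> f g lf fg; exact: length_preserving_inv fg lf.
- by move=> f g lf lg; exact: length_preserving_comp.
- have [_ [g _ cg]] := slide_about_a_length.1.
  have := length_preserving_comp slide_about_a_length (length_preserving_inv cg slide_about_a_length).
  by rewrite (_ : g \o slide_about_a = id) //; apply: funext => p /=; rewrite cg.1.
Qed.

(** ** Pairs moved by a subgroup *)

Definition moves_pair (G : set (airplane -> airplane)) (P Q P' Q' : component) : Prop :=
  exists g g', [/\ G g, inverse_maps g g', maps_component g P P' & maps_component g Q Q'].

Section MovesPair.
Variables (G : set (airplane -> airplane)) (sG : subgroup G).

Lemma moves_pair_trans P Q P1 Q1 P2 Q2 : moves_pair G P Q P1 Q1 ->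
  moves_pair G P1 Q1 P2 Q2 -> moves_pair G P Q P2 Q2.
Proof.
move=> [f [f' [Gf ff' fP fQ]]] [g [g' [Gg gg' gP gQ]]].
exists (g \o f), (f' \o g'); split.
- by have [_ GM _] := sG; exact: GM.
- exact: inverse_maps_comp.
- exact: maps_component_comp fP gP.
- exact: maps_component_comp fQ gQ.
Qed.

Lemma moves_pair_sym P Q P' Q' : moves_pair G P Q P' Q' -> moves_pair G P' Q' P Q.
Proof.
move=> [g [g' [Gg gg' gP gQ]]]; exists g', g; split.
- by have [_ _ GV] := sG; exact: GV gg'.
- exact: inverse_maps_sym.
- exact: maps_component_inv gg' gP.
- exact: maps_component_inv gg' gQ.
Qed.

(** A word in the generators is imitated letter by letter: the pairs met on the
    way still consist of distinct components. *)
Lemma moves_pair_generated :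
  (forall h P Q P' Q', generator h -> P <> Q -> maps_component h P P' ->
    maps_component h Q Q' -> moves_pair G P Q P' Q') ->
  forall f, generated f -> forall P Q P' Q', P <> Q ->
    maps_component f P P' -> maps_component f Q Q' -> moves_pair G P Q P' Q'.
Proof.
move=> imitate f; elim=> [|{}f h Gf IH gh|{}f h h' Gf IH gh hh'] P Q P' Q' PQ.
- move=> fP fQ; exists id, id; split=> //; by have [] := sG.
- move=> hfP hfQ.
  have [P1 fP] := generated_total Gf P; have [Q1 fQ] := generated_total Gf Q.
  have [g _ fg] := generated_inverse Gf.
  apply: moves_pair_trans (IH _ _ _ _ PQ fP fQ) (imitate h _ _ _ _ gh _ _ _).
  + move=> E; apply: PQ; apply: boundary_inj.
    by rewrite -(maps_component_inv fg fP) -(maps_component_inv fg fQ) E.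
  + by rewrite /maps_component -hfP -fP image_comp.
  + by rewrite /maps_component -hfQ -fQ image_comp.
- move=> hfP hfQ.
  have [P1 fP] := generated_total Gf P; have [Q1 fQ] := generated_total Gf Q.
  have [g _ hfg] := generated_inverse (generated_inv Gf gh hh').
  apply: moves_pair_trans (IH _ _ _ _ PQ fP fQ) (moves_pair_sym (imitate h _ _ _ _ gh _ _ _)).
  + move=> E; apply: PQ; apply: boundary_inj.
    by rewrite -(maps_component_inv hfg hfP) -(maps_component_inv hfg hfQ) E.
  + apply: (maps_component_inv (inverse_maps_sym hh')).
    by rewrite /maps_component -hfP -fP image_comp.
  + apply: (maps_component_inv (inverse_maps_sym hh')).
    by rewrite /maps_component -hfQ -fQ image_comp.
Qed.

Lemma moves_pair_two_transitive :
  (forall h P Q P' Q', generator h -> P <> Q -> maps_component h P P' ->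
    maps_component h Q Q' -> moves_pair G P Q P' Q') ->
  two_transitive_on_components G.
Proof.
move=> imitate P Q P' Q' PQ PQ'.
have [f Gf [fP fQ]] := reach_pairs PQ PQ'.
have [g [_ [Gg _ gP gQ]]] := moves_pair_generated imitate Gf PQ fP fQ.
by exists g.
Qed.

End MovesPair.

Lemma two_transitive_sub (G H : set (airplane -> airplane)) : G `<=` H ->
  two_transitive_on_components G -> two_transitive_on_components H.
Proof.
by move=> GH tG P Q P' Q' PQ PQ'; have [f [/GH Hf fP fQ]] := tG _ _ _ _ PQ PQ'; exists f.
Qed.

Lemma E_two_transitive : two_transitive_on_components E_subgroup.
Proof.
apply: (two_transitive_sub (G := length_preserving)).
  by move=> f [hf [Q dQ]]; exact: rule_diagram_E dQ.
apply: (moves_pair_two_transitive length_preserving_subgroup) => h P Q P' Q' gh _ hP hQ.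
have [f [lf fP fQ]] := generator_length_preserving gh hP hQ.
by have [_ [g _ fg]] := lf.1; exists f, g.
Qed.

Lemma T_A_two_transitive : two_transitive_on_components T_A.
Proof. by apply: two_transitive_sub E_two_transitive => f []. Qed.

(** * The derived subgroup *)

Lemma generator_T_A h : generator h -> T_A h.
Proof.
by case; (apply: (@rule_diagram_T_A (fun=> True)); [exact: rule_map_homeomorphism|exact: rule_map_diagram]).
Qed.

(** Each generator is the identity on the cell of some blue edge. *)
Lemma generator_fixes_pair h : generator h -> exists C C', [/\ C <> C',
  maps_component h C C & maps_component h C' C'].
Proof.
have fixed es es' L (chk : rules_check es es' L) e : (e, e, false) \in L ->
    blue_edge e -> blue_edge (rcons e b_p) ->
    exists C C', [/\ C <> C', maps_component (rule_map chk) C C &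
      maps_component (rule_map chk) C' C'].
  move=> eL eb ebp; exists (comp e), (comp (rcons e b_p)); split.
  - by move=> /(comp_inj eb ebp)/(congr1 size)/eqP; rewrite size_rcons eqn_leq ltnn andbF.
  - have := @rule_map_move _ _ _ chk (e, e, false) [::] eL.
    by rewrite /src /dst /= cats0; apply.
  - have := @rule_map_move _ _ _ chk (e, e, false) [:: b_p] eL.
    by rewrite /src /dst /= cats1; apply.
case.
- exact: (fixed _ _ _ _ [:: e_L]).
- exact: (fixed _ _ _ _ [:: e_L; b_p]).
- exact: (fixed _ _ _ _ [:: e_L]).
- exact: (fixed _ _ _ _ [:: e_L]).
- exact: (fixed _ _ _ _ [:: e_R]).
Qed.

Lemma derived_subgroup_subgroup G : subgroup (derived_subgroup G).
Proof.
split.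
- by move=> M [[M1 _ _] _].
- by move=> f g Df Dg M cM; have [[_ MM _] _] := cM; apply: MM; [exact: Df|exact: Dg].
- by move=> f g Df fg M cM; have [[_ _ MV] _] := cM; apply: MV fg; exact: Df.
Qed.

(** If [h] fixes the pair [(C, C')] and [g] moves it to [(P, Q)], then the
    commutator of [h] and [g] moves [(P, Q)] as [h] does. *)
Lemma derived_two_transitive : two_transitive_on_components (derived_subgroup T_A).
Proof.
apply: (moves_pair_two_transitive (derived_subgroup_subgroup T_A)) => h P Q P' Q' gh PQ hP hQ.
have [C [C' [CC' hC hC']]] := generator_fixes_pair gh.
have [g [Tg gC gC']] := T_A_two_transitive CC' PQ.
have Th := generator_T_A gh.
have [[_ [h' _ hh']] _] := Th; have [[_ [g' _ gg']] _] := Tg.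
exists (h \o g \o h' \o g'), (g \o (h \o (g' \o h'))); split.
- by move=> M [_ cM]; apply: cM; exists h, h', g, g'.
- apply: (inverse_maps_comp (inverse_maps_sym gg')).
  apply: (inverse_maps_comp (inverse_maps_sym hh')).
  exact: (inverse_maps_comp gg' hh').
- apply: maps_component_comp (maps_component_inv gg' gC) _.
  apply: maps_component_comp (maps_component_inv hh' hC) _.
  exact: maps_component_comp gC hP.
- apply: maps_component_comp (maps_component_inv gg' gC') _.
  apply: maps_component_comp (maps_component_inv hh' hC') _.
  exact: maps_component_comp gC' hQ.
Qed.

Theorem corollary8p4 :
  two_transitive_on_components E_subgroup /\
  two_transitive_on_components (derived_subgroup T_A) /\
  two_transitive_on_components T_A.
Proof.
split; first exact: E_two_transitive.
split; [exact: derived_two_transitive|exact: T_A_two_transitive].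
Qed.
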